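(* Let $L=L_{\bar 0}\oplus L_{\bar 1}$ be a nilpotent Lie superalgebra of dimension $(k\mid l)$ with $\dim L^2=(1\mid 0)$. Then $\mathcal{M}^{(2)}(L)$ is isomorphic to one of the following three abelian Lie superalgebras: $$A\Big(\tfrac13 k(k-1)(k+1)+(k-1)(l^2-k)\ \Big|\ \tfrac13 l(l-1)(l+1)+l(k-1)^2\Big),$$ $$A\Big(\tfrac13 k(k-1)(k+1)+(k-1)(l^2-k)+1\ \Big|\ \tfrac13 l(l-1)(l+1)+l(k-1)^2+1\Big),$$ $$A\Big(\tfrac13 k(k-1)(k+1)+(k-1)(l^2-k)+3\ \Big|\ \tfrac13 l(l-1)(l+1)+l(k-1)^2\Big).$$
   Context: Lie superalgebras are over a fixed algebraically closed ground field. For $L=L_{\bar 0}\oplus L_{\bar 1}$, writing $\dim L=(k\mid l)$ means $\dim L_{\bar 0}=k$ and $\dim L_{\bar 1}=l$. $A(a\mid b)$ denotes the abelian Lie superalgebra of dimension $(a\mid b)$. $L^2=[L,L]$ is the derived subalgebra. A free presentation of $L$ is a short exact sequence $0\to R\to F\to L\to 0$ of Lie superalgebras with $F$ a free Lie superalgebra (on a $\mathbb{Z}_2$-graded set) and $R$ a graded ideal of $F$. The $2$-nilpotent multiplier is $\mathcal{M}^{(2)}(L)=\dfrac{R\cap F^3}{[[R,F],F]}$, where $F^3=[[F,F],F]$ is the third term of the lower central series of $F$; it is an abelian Lie superalgebra and, up to isomorphism, independent of the chosen free presentation. *)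

(* Defs.v *)
From HB Require Import structures.
From mathcomp Require Import all_boot all_order all_algebra.
From mathcomp Require Import generic_quotient ring_quotient.
From mathcomp Require Import boolp.

Set Implicit Arguments.
Unset Strict Implicit.
Unset Printing Implicit Defensive.

Import GRing.Theory.
Local Open Scope ring_scope.
Local Open Scope quotient_scope.

(** The Z/2-grading [L = L_0 (+) L_1] is given by its two projections:
    [part i x] is the component of [x] of parity [i] ([false] is even), so that
    [L_i = {x | part i x = x}].

    The last two axioms follow from [brk_skew] as soon as 2 is invertible, and
    from [brk_jacobi] as soon as 3 is invertible, respectively.  They belong to
    the usual definition in small characteristic, so that no hypothesis on the
    characteristic of [K] is needed. *)
HB.mixin Record Lmodule_isLieSuperalgebra (K : fieldType) L
    of GRing.Lmodule K L := {
  part : bool -> L -> L;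
  brk : L -> L -> L;
  part_linear : forall i, linear (part i);
  part_sum : forall x, part false x + part true x = x;
  part_part : forall i j x, part i (part j x) = if i == j then part j x else 0;
  brk_linearl : forall y, linear (fun x => brk x y);
  brk_linearr : forall x, linear (brk x);
  brk_part : forall i j x y, part i x = x -> part j y = y ->
    part (i (+) j) (brk x y) = brk x y;
  brk_skew : forall i j x y, part i x = x -> part j y = y ->
    brk x y = - ((-1) ^+ (i && j) *: brk y x);
  brk_jacobi : forall i j x y z, part i x = x -> part j y = y ->
    brk x (brk y z) = brk (brk x y) z + (-1) ^+ (i && j) *: brk y (brk x z);
  brk_even : forall x, part false x = x -> brk x x = 0;
  brk_odd : forall x, part true x = x -> brk x (brk x x) = 0
}.

#[short(type="lieSuperalgType")]
HB.structure Definition LieSuperalgebra (K : fieldType) :=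
  {L of GRing.Lmodule K L & Lmodule_isLieSuperalgebra K L}.

HB.instance Definition _ (K : fieldType) (L : lieSuperalgType K) i :=
  GRing.isLinear.Build K L L *:%R (@part K L i) (@part_linear K L i).

Section BracketTheory.
Variables (K : fieldType) (L : lieSuperalgType K).
Implicit Types x y z : L.

Lemma brkDl x y z : brk (x + y) z = brk x z + brk y z.
Proof. by have := @brk_linearl K L z 1 x y; rewrite !scale1r. Qed.

Lemma brkDr x y z : brk x (y + z) = brk x y + brk x z.
Proof. by have := @brk_linearr K L x 1 y z; rewrite !scale1r. Qed.

Lemma brk0l x : brk 0 x = 0.
Proof. by apply: (addrI (brk 0 x)); rewrite -brkDl !addr0. Qed.

Lemma brk0r x : brk x 0 = 0.
Proof. by apply: (addrI (brk x 0)); rewrite -brkDr !addr0. Qed.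

Lemma brkZl a x y : brk (a *: x) y = a *: brk x y.
Proof. by have := @brk_linearl K L y a x 0; rewrite !addr0 brk0l addr0. Qed.

Lemma brkZr a x y : brk x (a *: y) = a *: brk x y.
Proof. by have := @brk_linearr K L x a y 0; rewrite !addr0 brk0r addr0. Qed.

Lemma brkNl x y : brk (- x) y = - brk x y.
Proof. by rewrite -scaleN1r brkZl scaleN1r. Qed.

Lemma brkNr x y : brk x (- y) = - brk x y.
Proof. by rewrite -scaleN1r brkZr scaleN1r. Qed.

Lemma part_id i x : part i (part i x) = part i x.
Proof. by rewrite part_part eqxx. Qed.

Lemma part_eq i j x : part i x = x -> part j x = if j == i then x else 0.
Proof. by move=> ix; rewrite -ix part_part ix. Qed.

End BracketTheory.

Section Morphisms.
Variables (K : fieldType) (L M : lieSuperalgType K).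

Definition is_lie_hom (f : L -> M) : Prop :=
  [/\ linear f, forall i x, f (part i x) = part i (f x)
    & forall x y, f (brk x y) = brk (f x) (f y)].

Definition lie_isomorphic : Prop :=
  exists f : L -> M, is_lie_hom f /\ bijective f.

End Morphisms.

Section Graded.
Variables (K : fieldType) (L : lieSuperalgType K).

Record gradedSubspace := GradedSubspace {
  gset :> L -> Prop;
  gset0 : gset 0;
  gset_linear : forall a x y, gset x -> gset y -> gset (a *: x + y);
  gset_part : forall i x, gset x -> gset (part i x)
}.

Implicit Types A B : gradedSubspace.

Definition is_subalgebra A : Prop := forall x y, A x -> A y -> A (brk x y).

Definition is_ideal A : Prop :=
  forall x y, A x -> A (brk x y) /\ A (brk y x).

Lemma gsetD A x y : A x -> A y -> A (x + y).
Proof. by move=> Ax Ay; rewrite -[x]scale1r; apply: gset_linear. Qed.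

Lemma gsetZ A a x : A x -> A (a *: x).
Proof. by move=> Ax; rewrite -[_ *: _]addr0; apply: gset_linear => //; apply: gset0. Qed.

Lemma gset_sum A n (F : 'I_n -> L) : (forall i, A (F i)) -> A (\sum_i F i).
Proof.
by move=> AF; elim/big_ind: _ => //; [apply: gset0 | exact: gsetD].
Qed.

Definition gfull : gradedSubspace :=
  @GradedSubspace (fun=> True) Logic.I (fun _ _ _ _ _ => Logic.I)
    (fun _ _ _ => Logic.I).

Definition gcap_set A B (x : L) : Prop := A x /\ B x.

Lemma gcap0 A B : gcap_set A B 0. Proof. by split; apply: gset0. Qed.

Lemma gcap_linear A B a x y :
  gcap_set A B x -> gcap_set A B y -> gcap_set A B (a *: x + y).
Proof. by move=> [? ?] [? ?]; split; apply: gset_linear. Qed.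

Lemma gcap_part A B i x : gcap_set A B x -> gcap_set A B (part i x).
Proof. by move=> [? ?]; split; apply: gset_part. Qed.

Definition gcap A B : gradedSubspace :=
  GradedSubspace (gcap0 A B) (@gcap_linear A B) (@gcap_part A B).

(** [[A, B]]: the linear span of the brackets [[a, b]], for [a] in [A] and [b]
    in [B].  Scalars are absorbed by [A]. *)
Definition gbrk_set A B (v : L) : Prop :=
  exists n (a b : 'I_n -> L),
    [/\ forall i, A (a i), forall i, B (b i) & v = \sum_i brk (a i) (b i)].

Lemma gbrk_mem A B x y : A x -> B y -> gbrk_set A B (brk x y).
Proof.
by move=> Ax By; exists 1%N, (fun=> x), (fun=> y); split=> //; rewrite big_ord1.
Qed.

Lemma gbrk0 A B : gbrk_set A B 0.
Proof.
by rewrite -(brk0l 0); apply: gbrk_mem; apply: gset0.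
Qed.

Lemma gbrkD A B x y : gbrk_set A B x -> gbrk_set A B y -> gbrk_set A B (x + y).
Proof.
move=> [n [a [b [Aa Bb ->]]]] [m [c [d [Ac Bd ->]]]].
pose glue (u : 'I_n -> L) (v : 'I_m -> L) (i : 'I_(n + m)) :=
  match split i with inl j => u j | inr j => v j end.
exists (n + m)%N, (glue a c), (glue b d); split.
- by move=> i; rewrite /glue; case: (split i).
- by move=> i; rewrite /glue; case: (split i).
rewrite big_split_ord /=; congr (_ + _); apply: eq_bigr => i _; rewrite /glue.
  by rewrite (unsplitK (inl i : 'I_n + 'I_m)).
by rewrite (unsplitK (inr i : 'I_n + 'I_m)).
Qed.

Lemma gbrk_sum A B n (F : 'I_n -> L) :
  (forall i, gbrk_set A B (F i)) -> gbrk_set A B (\sum_i F i).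
Proof.
by move=> AF; elim/big_ind: _ => //; [apply: gbrk0 | exact: gbrkD].
Qed.

Lemma gbrkZ A B c x : gbrk_set A B x -> gbrk_set A B (c *: x).
Proof.
move=> [n [a [b [Aa Bb ->]]]]; rewrite scaler_sumr; apply: gbrk_sum => i.
by rewrite -brkZl; apply: gbrk_mem => //; apply: gsetZ.
Qed.

Lemma gbrk_linear A B c x y :
  gbrk_set A B x -> gbrk_set A B y -> gbrk_set A B (c *: x + y).
Proof. by move=> /gbrkZ ABx ABy; apply: gbrkD. Qed.

Lemma part_brk i (x y : L) :
  part i (brk x y) =
  brk (part false x) (part i y) + brk (part true x) (part (~~ i) y).
Proof.
have h p q (u v : L) : part p (brk (part q u) (part (p (+) q) v)) =
                        brk (part q u) (part (p (+) q) v).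
  have {1}-> : p = q (+) (p (+) q) by case: p; case: q.
  by apply: brk_part; apply: part_id.
have h0 p q (u v : L) : part p (brk (part q u) (part (~~ (p (+) q)) v)) = 0.
  rewrite (@part_eq _ _ (~~ p)); first by case: p.
  by have := h (~~ p) q u v; rewrite addNb.
rewrite -{1}(part_sum x) brkDl -{1 2}(part_sum y) !brkDr !linearD /=.
have := h i false x y; have := h i true x y.
have := h0 i false x y; have := h0 i true x y.
by case: i => /= -> -> -> ->; rewrite !(addr0, add0r).
Qed.

Lemma gbrk_part A B i x : gbrk_set A B x -> gbrk_set A B (part i x).
Proof.
move=> [n [a [b [Aa Bb ->]]]]; rewrite linear_sum; apply: gbrk_sum => j /=.
by rewrite part_brk; apply: gbrkD; apply: gbrk_mem; apply: gset_part.
Qed.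

Definition gbrk A B : gradedSubspace :=
  GradedSubspace (gbrk0 A B) (@gbrk_linear A B) (@gbrk_part A B).

Lemma ideal_brkr A : (forall x y, A x -> A (brk y x)) -> is_ideal A.
Proof.
move=> idA x y Ax; split; last exact: idA.
rewrite -(part_sum x) -(part_sum y) !(brkDl, brkDr).
have h i j : A (brk (part i x) (part j y)).
  rewrite (brk_skew _ _ _ _ (part_id i x) (part_id j y)) -scaleNr.
  by apply: gsetZ; apply: idA; apply: gset_part.
by do !apply: gsetD.
Qed.

Lemma ideal_subalgebra A : is_ideal A -> is_subalgebra A.
Proof. by move=> idA x y Ax _; case: (idA x y Ax). Qed.

Lemma gfull_ideal : is_ideal gfull. Proof. by []. Qed.

Lemma gcap_ideal A B : is_ideal A -> is_ideal B -> is_ideal (gcap A B).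
Proof.
move=> idA idB x y [/(idA x y) [? ?] /(idB x y) [? ?]]; by split; split.
Qed.

Lemma gbrk_ideal A B : is_ideal A -> is_ideal B -> is_ideal (gbrk A B).
Proof.
move=> idA idB; apply: ideal_brkr => _ y [n [a [b [Aa Bb ->]]]].
have -> : brk y (\sum_i brk (a i) (b i)) = \sum_i brk y (brk (a i) (b i)).
  by elim/big_ind2: _ => [|u u' v v' <- <-|//]; rewrite ?brk0r ?brkDr.
apply: (@gset_sum (gbrk A B)) => i.
have h p q : gbrk A B (brk (part p y) (brk (part q (a i)) (b i))).
  rewrite (brk_jacobi _ _ _ _ _ (part_id p y) (part_id q (a i))).
  apply: gsetD; last apply: gsetZ; apply: gbrk_mem => //.
  - by apply: (idA _ _ _).2; apply: gset_part.
  - exact: gset_part.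
  - exact: (idB _ _ _).2.
rewrite -(part_sum y) -(part_sum (a i)) !(brkDl, brkDr).
by do !apply: gsetD.
Qed.

(** [lcs n] is the [n]-th term [L^n], with [L^1 = L] and
    [L^(n+1) = [L^n, L]]. *)
Definition lcs n : gradedSubspace := iter n.-1 (gbrk^~ gfull) gfull.

Lemma lcs_ideal n : is_ideal (lcs n).
Proof.
rewrite /lcs; elim: n.-1 => [|m idm] /=; first exact: gfull_ideal.
by apply: gbrk_ideal => //; apply: gfull_ideal.
Qed.

Definition nilpotent_lie : Prop := exists n, forall x, lcs n x -> x = 0.

Definition is_basis (S : L -> Prop) n (e : 'I_n -> L) : Prop :=
  (forall x, S x <-> exists c : 'I_n -> K, x = \sum_i c i *: e i) /\
  (forall c : 'I_n -> K, \sum_i c i *: e i = 0 -> forall i, c i = 0).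

Definition has_sdim A (k l : nat) : Prop :=
  (exists e : 'I_k -> L, is_basis (fun x => A x /\ part false x = x) e) /\
  (exists e : 'I_l -> L, is_basis (fun x => A x /\ part true x = x) e).

End Graded.

Arguments gfull {K L}.
Arguments lcs {K} L n.
Arguments nilpotent_lie {K} L.

Section Preimage.
Variables (K : fieldType) (L M : lieSuperalgType K) (f : L -> M).
Hypothesis hf : is_lie_hom f.
Variable A : gradedSubspace M.

Lemma lie_hom0 : f 0 = 0.
Proof.
case: hf => lf _ _; have := lf (-1) 0 0.
by rewrite scaler0 addr0 scaleN1r addNr.
Qed.

Lemma gpreim0 : A (f 0).
Proof. by rewrite lie_hom0; apply: gset0. Qed.

Lemma gpreim_linear a x y : A (f x) -> A (f y) ->
  A (f (a *: x + y)).
Proof.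
by case: hf => lf _ _; rewrite lf => *; apply: gset_linear.
Qed.

Lemma gpreim_part i x : A (f x) -> A (f (part i x)).
Proof. by case: hf => _ pf _; rewrite pf => *; apply: gset_part. Qed.

Definition gpreim : gradedSubspace L :=
  @GradedSubspace K L (fun x => A (f x)) gpreim0 gpreim_linear gpreim_part.

Lemma gpreim_ideal : is_ideal A -> is_ideal gpreim.
Proof. by case: hf => _ _ bf idA x y Ax; rewrite /= !bf; apply: idA. Qed.

End Preimage.

Section Kernel.
Variables (K : fieldType) (L M : lieSuperalgType K).

Lemma gzero_linear a (x y : M) :
  x = 0 -> y = 0 -> a *: x + y = 0.
Proof. by move=> /= -> ->; rewrite scaler0 addr0. Qed.

Lemma gzero_part i (x : M) : x = 0 -> part i x = 0.
Proof. by move=> /= ->; rewrite linear0. Qed.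

Definition gzero : gradedSubspace M :=
  @GradedSubspace K M (fun x => x = 0) erefl gzero_linear gzero_part.

Lemma gzero_ideal : is_ideal gzero.
Proof. by move=> x y /= ->; rewrite brk0l brk0r. Qed.

Definition gker (f : L -> M) (hf : is_lie_hom f) : gradedSubspace L :=
  gpreim hf gzero.

Lemma gker_ideal (f : L -> M) (hf : is_lie_hom f) : is_ideal (gker hf).
Proof. exact/gpreim_ideal/gzero_ideal. Qed.

End Kernel.

Section Subalgebra.
Variables (K : fieldType) (L : lieSuperalgType K) (A : gradedSubspace L).

Definition gmem : {pred L} := fun x => `[< A x >].

Lemma gmem_submod : submod_closed gmem.
Proof.
split; first by apply/asboolP; apply: gset0.
by move=> a x y /asboolP Ax /asboolP Ay; apply/asboolP; apply: gset_linear.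
Qed.

HB.instance Definition _ := GRing.isSubmodClosed.Build K L gmem gmem_submod.

Record subLie (algA : is_subalgebra A) :=
  SubLie { subLie_val : L; subLie_valP : gmem subLie_val }.

Variable algA : is_subalgebra A.
Local Notation S := (subLie algA).

HB.instance Definition _ := [isSub for @subLie_val algA].
HB.instance Definition _ := [Choice of S by <:].
HB.instance Definition _ := [SubChoice_isSubZmodule of S by <:].
HB.instance Definition _ := [SubZmodule_isSubLmodule of S by <:].

Lemma subLieP (u : S) : A (val u).
Proof. by case: u => x /= /asboolP. Qed.

Definition sub_part i (u : S) : S :=
  SubLie algA (asboolT (gset_part i (subLieP u))).

Definition sub_brk (u v : S) : S :=
  SubLie algA (asboolT (algA (subLieP u) (subLieP v))).

Lemma sub_part_linear i : linear (sub_part i).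
Proof. by move=> a u v; apply: val_inj; rewrite /= linearP. Qed.

Lemma sub_part_sum u : sub_part false u + sub_part true u = u.
Proof. by apply: val_inj; rewrite /= part_sum. Qed.

Lemma sub_part_part i j u :
  sub_part i (sub_part j u) = if i == j then sub_part j u else 0.
Proof. by apply: val_inj; rewrite /= part_part; case: eqP. Qed.

Lemma sub_brk_linearl v : linear (fun u => sub_brk u v).
Proof. by move=> a u w; apply: val_inj; rewrite /= brkDl brkZl. Qed.

Lemma sub_brk_linearr u : linear (sub_brk u).
Proof. by move=> a v w; apply: val_inj; rewrite /= brkDr brkZr. Qed.

Lemma sub_brk_part i j u v : sub_part i u = u -> sub_part j v = v ->
  sub_part (i (+) j) (sub_brk u v) = sub_brk u v.
Proof.
move=> /(congr1 val) /= iu /(congr1 val) /= jv.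
by apply: val_inj; rewrite /= brk_part.
Qed.

Lemma sub_brk_skew i j u v : sub_part i u = u -> sub_part j v = v ->
  sub_brk u v = - ((-1) ^+ (i && j) *: sub_brk v u).
Proof.
move=> /(congr1 val) /= iu /(congr1 val) /= jv.
by apply: val_inj; rewrite /= (brk_skew _ _ _ _ iu jv).
Qed.

Lemma sub_brk_jacobi i j u v w : sub_part i u = u -> sub_part j v = v ->
  sub_brk u (sub_brk v w) =
  sub_brk (sub_brk u v) w + (-1) ^+ (i && j) *: sub_brk v (sub_brk u w).
Proof.
move=> /(congr1 val) /= iu /(congr1 val) /= jv.
by apply: val_inj; rewrite /= (brk_jacobi _ _ _ _ _ iu jv).
Qed.

Lemma sub_brk_even u : sub_part false u = u -> sub_brk u u = 0.
Proof. by move=> /(congr1 val) /= hu; apply: val_inj; rewrite /= brk_even. Qed.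

Lemma sub_brk_odd u : sub_part true u = u -> sub_brk u (sub_brk u u) = 0.
Proof. by move=> /(congr1 val) /= hu; apply: val_inj; rewrite /= brk_odd. Qed.

HB.instance Definition _ := Lmodule_isLieSuperalgebra.Build K S
  sub_part_linear sub_part_sum sub_part_part sub_brk_linearl sub_brk_linearr
  sub_brk_part sub_brk_skew sub_brk_jacobi sub_brk_even sub_brk_odd.

Lemma subLie_val_hom : is_lie_hom (val : S -> L).
Proof. by []. Qed.

End Subalgebra.

Section QuotientLie.
Variables (K : fieldType) (L : lieSuperalgType K) (I : gradedSubspace L).

Definition quotLie (idI : is_ideal I) := Quotient.quot (gmem I).

Variable idI : is_ideal I.
Local Notation Q := (quotLie idI).

HB.instance Definition _ := GRing.Zmodule.on Q.
HB.instance Definition _ := EqQuotient.on Q.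

Definition quot_pi (x : L) : Q := \pi_(Quotient.quot (gmem I)) x.

Lemma quot_piP x y : quot_pi x = quot_pi y <-> I (x - y).
Proof.
split=> [/eqP|Ixy]; first by rewrite -Quotient.idealrBE => /asboolP.
by apply/eqP; rewrite -Quotient.idealrBE; apply/asboolP.
Qed.

Lemma quot_piD : {morph quot_pi : x y / x + y}.
Proof. by move=> x y; rewrite /quot_pi !piE. Qed.

Lemma quot_piN : {morph quot_pi : x / - x}.
Proof. by move=> x; rewrite /quot_pi !piE. Qed.

Lemma quot_pi0 : quot_pi 0 = 0.
Proof. by rewrite /quot_pi !piE. Qed.

Lemma quot_reprK (u : Q) : quot_pi (repr u) = u.
Proof. exact: reprK. Qed.

Lemma quot_ind (P : Q -> Prop) : (forall x, P (quot_pi x)) -> forall u, P u.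
Proof. by move=> Pp u; rewrite -(quot_reprK u). Qed.

Lemma quot_reprP x : I (repr (quot_pi x) - x).
Proof. by apply/quot_piP; rewrite quot_reprK. Qed.

Definition quot_scale (a : K) (u : Q) : Q := quot_pi (a *: repr u).
Definition quot_part i (u : Q) : Q := quot_pi (part i (repr u)).
Definition quot_brk (u v : Q) : Q := quot_pi (brk (repr u) (repr v)).

Lemma quot_scaleE a x : quot_scale a (quot_pi x) = quot_pi (a *: x).
Proof. by apply/quot_piP; rewrite -scalerBr; apply/gsetZ/quot_reprP. Qed.

Lemma quot_partE i x : quot_part i (quot_pi x) = quot_pi (part i x).
Proof. by apply/quot_piP; rewrite -linearB; apply/gset_part/quot_reprP. Qed.

Lemma quot_brkE x y : quot_brk (quot_pi x) (quot_pi y) = quot_pi (brk x y).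
Proof.
apply/quot_piP; set x' := repr _; set y' := repr _.
have -> : brk x' y' - brk x y = brk (x' - x) y' + brk x (y' - y).
  by rewrite brkDl brkDr brkNl brkNr addrA subrK.
apply: gsetD; first by apply: (idI _ _).1; apply: quot_reprP.
by apply: (idI _ _).2; apply: quot_reprP.
Qed.

Lemma quot_scaleA a b u : quot_scale a (quot_scale b u) = quot_scale (a * b) u.
Proof. by elim/quot_ind: u => x; rewrite !quot_scaleE scalerA. Qed.

Lemma quot_scale1 : left_id 1 quot_scale.
Proof. by elim/quot_ind => x; rewrite !quot_scaleE scale1r. Qed.

Lemma quot_scaleDr : right_distributive quot_scale +%R.
Proof.
move=> a; elim/quot_ind=> x; elim/quot_ind=> y.
by rewrite -quot_piD !quot_scaleE -quot_piD scalerDr.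
Qed.

Lemma quot_scaleDl u : {morph quot_scale^~ u : a b / a + b}.
Proof.
move=> a b; elim/quot_ind: u => x.
by rewrite !quot_scaleE -quot_piD scalerDl.
Qed.

HB.instance Definition _ := GRing.Zmodule_isLmodule.Build K Q
  quot_scaleA quot_scale1 quot_scaleDr quot_scaleDl.

Lemma quot_piZ a x : quot_pi (a *: x) = a *: quot_pi x.
Proof. by rewrite -quot_scaleE. Qed.

Lemma quot_part_ind i (P : Q -> Prop) :
  (forall x, part i x = x -> P (quot_pi x)) ->
  forall u, quot_part i u = u -> P u.
Proof.
move=> Pp u <-; elim/quot_ind: u => x; rewrite quot_partE.
by apply: Pp; apply: part_id.
Qed.

Lemma quot_part_linear i : linear (quot_part i).
Proof.
move=> a; elim/quot_ind=> x; elim/quot_ind=> y.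
by rewrite -quot_piZ -quot_piD !quot_partE -quot_piZ -quot_piD linearP.
Qed.

Lemma quot_part_sum u : quot_part false u + quot_part true u = u.
Proof. by elim/quot_ind: u => x; rewrite !quot_partE -quot_piD part_sum. Qed.

Lemma quot_part_part i j u :
  quot_part i (quot_part j u) = if i == j then quot_part j u else 0.
Proof.
elim/quot_ind: u => x; rewrite !quot_partE part_part.
by case: eqP => // _; apply: quot_pi0.
Qed.

Lemma quot_brk_linearl v : linear (fun u => quot_brk u v).
Proof.
move=> a; elim/quot_ind=> x; elim/quot_ind=> y; elim/quot_ind: v => z.
by rewrite -quot_piZ -quot_piD !quot_brkE -quot_piZ -quot_piD brkDl brkZl.
Qed.

Lemma quot_brk_linearr u : linear (quot_brk u).
Proof.
move=> a; elim/quot_ind=> x; elim/quot_ind=> y; elim/quot_ind: u => z.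
by rewrite -quot_piZ -quot_piD !quot_brkE -quot_piZ -quot_piD brkDr brkZr.
Qed.

Lemma quot_brk_part i j u v : quot_part i u = u -> quot_part j v = v ->
  quot_part (i (+) j) (quot_brk u v) = quot_brk u v.
Proof.
elim/quot_part_ind=> x ix; elim/quot_part_ind=> y jy.
by rewrite quot_brkE quot_partE brk_part.
Qed.

Lemma quot_brk_skew i j u v : quot_part i u = u -> quot_part j v = v ->
  quot_brk u v = - ((-1) ^+ (i && j) *: quot_brk v u).
Proof.
elim/quot_part_ind=> x ix; elim/quot_part_ind=> y jy.
by rewrite !quot_brkE -quot_piZ -quot_piN -brk_skew.
Qed.

Lemma quot_brk_jacobi i j u v w : quot_part i u = u -> quot_part j v = v ->
  quot_brk u (quot_brk v w) =
  quot_brk (quot_brk u v) w + (-1) ^+ (i && j) *: quot_brk v (quot_brk u w).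
Proof.
elim/quot_part_ind=> x ix; elim/quot_part_ind=> y jy; elim/quot_ind: w => z.
by rewrite !quot_brkE -quot_piZ -quot_piD -brk_jacobi.
Qed.

Lemma quot_brk_even u : quot_part false u = u -> quot_brk u u = 0.
Proof.
by elim/quot_part_ind=> x hx; rewrite quot_brkE brk_even // quot_pi0.
Qed.

Lemma quot_brk_odd u : quot_part true u = u -> quot_brk u (quot_brk u u) = 0.
Proof.
by elim/quot_part_ind=> x hx; rewrite !quot_brkE brk_odd // quot_pi0.
Qed.

HB.instance Definition _ := Lmodule_isLieSuperalgebra.Build K Q
  quot_part_linear quot_part_sum quot_part_part quot_brk_linearl
  quot_brk_linearr quot_brk_part quot_brk_skew quot_brk_jacobi quot_brk_even
  quot_brk_odd.

Lemma quot_pi_hom : is_lie_hom quot_pi.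
Proof.
split=> [a x y|i x|x y]; first by rewrite quot_piD quot_piZ.
  by rewrite -quot_partE.
by rewrite -quot_brkE.
Qed.

End QuotientLie.

Definition abelian_lie (K : fieldType) (a b : nat) : Type :=
  ('rV[K]_a * 'rV[K]_b)%type.

Section Abelian.
Variables (K : fieldType) (a b : nat).
Local Notation A := (abelian_lie K a b).

HB.instance Definition _ := GRing.Lmodule.on A.

Definition ab_part (i : bool) (u : A) : A := if i then (0, u.2) else (u.1, 0).
Definition ab_brk (u v : A) : A := 0.

Lemma ab_part_linear i : linear (ab_part i).
Proof.
by case: i => c [u1 u2] [v1 v2]; apply: injective_projections;
   rewrite /= ?scaler0 ?addr0.
Qed.

Lemma ab_part_sum u : ab_part false u + ab_part true u = u.
Proof. by case: u => u1 u2; apply: injective_projections; rewrite /= ?addr0 ?add0r. Qed.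

Lemma ab_part_part i j u :
  ab_part i (ab_part j u) = if i == j then ab_part j u else 0.
Proof. by case: i; case: j. Qed.

Lemma ab_brk_linearl v : linear (fun u => ab_brk u v).
Proof. by move=> c u w; rewrite /ab_brk scaler0 addr0. Qed.

Lemma ab_brk_linearr u : linear (ab_brk u).
Proof. by move=> c v w; rewrite /ab_brk scaler0 addr0. Qed.

Lemma ab_brk_part i j u v : ab_part i u = u -> ab_part j v = v ->
  ab_part (i (+) j) (ab_brk u v) = ab_brk u v.
Proof. by case: (i (+) j). Qed.

Lemma ab_brk_skew i j u v : ab_part i u = u -> ab_part j v = v ->
  ab_brk u v = - ((-1) ^+ (i && j) *: ab_brk v u).
Proof. by rewrite /ab_brk scaler0 oppr0. Qed.

Lemma ab_brk_jacobi i j u v w : ab_part i u = u -> ab_part j v = v ->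
  ab_brk u (ab_brk v w) =
  ab_brk (ab_brk u v) w + (-1) ^+ (i && j) *: ab_brk v (ab_brk u w).
Proof. by rewrite /ab_brk scaler0 addr0. Qed.

HB.instance Definition _ := Lmodule_isLieSuperalgebra.Build K A
  ab_part_linear ab_part_sum ab_part_part ab_brk_linearl ab_brk_linearr
  ab_brk_part ab_brk_skew ab_brk_jacobi
  (fun _ _ => erefl) (fun _ _ => erefl).

End Abelian.

(** Freeness on the Z/2-graded set [(X, deg)], by its universal property. *)
Definition is_free_lie (K : fieldType) (F : lieSuperalgType K) (X : Type)
    (deg : X -> bool) (iota : X -> F) : Prop :=
  (forall x, part (deg x) (iota x) = iota x) /\
  forall (H : lieSuperalgType K) (h : X -> H),
    (forall x, part (deg x) (h x) = h x) ->
    exists phi : F -> H,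
      [/\ is_lie_hom phi, forall x, phi (iota x) = h x
        & forall psi : F -> H, is_lie_hom psi ->
            (forall x, psi (iota x) = h x) -> psi =1 phi].

Record freePresentation (K : fieldType) (L : lieSuperalgType K) :=
  FreePresentation {
    fp_alg : lieSuperalgType K;
    fp_gens : Type;
    fp_deg : fp_gens -> bool;
    fp_iota : fp_gens -> fp_alg;
    fp_free : is_free_lie fp_deg fp_iota;
    fp_map : fp_alg -> L;
    fp_hom : is_lie_hom fp_map;
    fp_surj : forall y, exists x, fp_map x = y
  }.

Section Multiplier.
Variables (K : fieldType) (L : lieSuperalgType K) (P : freePresentation L).

Local Notation F := (fp_alg P).
Local Notation R := (gker (fp_hom P)).

Definition mult2_num : gradedSubspace F := gcap R (lcs F 3).

Definition mult2_den : gradedSubspace F := gbrk (gbrk R gfull) gfull.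

Lemma mult2_num_alg : is_subalgebra mult2_num.
Proof.
apply/ideal_subalgebra/gcap_ideal; [exact: gker_ideal | exact: lcs_ideal].
Qed.

Lemma mult2_den_sub x : mult2_den x -> mult2_num x.
Proof.
have gbrkW (A B C : gradedSubspace F) : (forall z, A z -> B z) ->
    forall z, gbrk A C z -> gbrk B C z.
  by move=> AB z [n [a [b [Aa Cb ->]]]]; exists n, a, b; split=> // i; apply: AB.
have gbrkS (A : gradedSubspace F) : is_ideal A -> forall z, gbrk A gfull z -> A z.
  move=> idA z [n [a [b [Aa _ ->]]]]; apply: gset_sum => i.
  exact: (idA _ _ _).1.
have idR : is_ideal R by apply: gker_ideal.
move=> h; split; last by move: x h; do 2!apply: (gbrkW).
by apply: (gbrkS R) => //; apply: (gbrkW _ _ _ (gbrkS R idR)).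
Qed.

Lemma mult2_den_ideal : is_ideal mult2_den.
Proof. by do 2!apply: gbrk_ideal => //; apply: gker_ideal. Qed.

(** [[[R, F], F]], as an ideal of [R] meet [F^3]; it is contained in it by
    [mult2_den_sub]. *)
Definition mult2_den_in : gradedSubspace (subLie mult2_num_alg) :=
  gpreim (subLie_val_hom mult2_num_alg) mult2_den.

Lemma mult2_den_in_ideal : is_ideal mult2_den_in.
Proof. exact/gpreim_ideal/mult2_den_ideal. Qed.

Definition multiplier2 : lieSuperalgType K := quotLie mult2_den_in_ideal.

End Multiplier.

(* Main.v *)
From HB Require Import structures.
From mathcomp Require Import all_boot all_order all_algebra.
From mathcomp Require Import boolp.
From mathcomp Require Import ring lra zify.
Require Import Defs.

(** Write [L^2 = K z] with [z] even; nilpotency makes [z] central, so [L^3 = 0].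
    Let [V = L / L^2], of dimension [(m | l)] with [m = k - 1], and let
    [0 -> R -> F -> L -> 0] be a free presentation, [D = [[R, F], F]].  Then
    [F^3] is contained in [R], so the multiplier is [F^3 / D].  Homogeneous
    lifts [v_i] of a basis of [V] and a bracket [c] lifting [z] span [F]
    modulo [R], whence [F^3 / D] is spanned by

    - the brackets [[[v_i, v_j], v_k]] with [j < i] and [j <= k]: skew symmetry
      and the Jacobi identity reduce all others to these ([hall_span_lcs3]);
    - the brackets [[[c, f], g]], of degree four.

    The brackets of the first kind are independent modulo degree four
    ([hall_free]).  There are [m (m^2 - 1) / 3 + m l^2] even and
    [l (l^2 - 1) / 3 + l m^2] odd ones ([card_hall_even], [card_hall_odd]),
    which are the numbers [f0] and [f1] of the statement.

    The degree four part depends on the form [omega] on [V] given by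
    [[x, y] = omega (x, y) z].
    If some odd [y] has [[y, y] <> 0], then [[c, f]] lies in [[R, F]] for
    every [f], because [[y, [y, y]] = 0], and nothing is added.
    Otherwise [omega] is alternating.  Choose homogeneous [u1] and [u2] with
    [[u1, u2] = z]; they have the same parity.  If the rank is at least four, a
    pair orthogonal to both provides another lift of [z], which shows that
    [[c, f]] lies in [[R, F]] again.  If the rank is two, the radical of
    [omega] drops out and, writing [u1] and [u2] for lifts as well, exactly
    [[[c, u1], u1]], [[[c, u1], u2]], [[[c, u2], u2]] survive, all even
    ([quartic_rank2]).  The parity of [u1] and [u2] may be odd, but only in
    characteristic two.  Hence the multiplier has dimension [(f0 | f1)] or
    [(f0 + 3 | f1)].

    Independence is obtained from homomorphisms of [F] into Lie superalgebras
    of matrices.  The coefficient of a word [w_1 ... w_d] in a polynomial of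
    the tensor algebra is the top right entry of its value when a variable [x]
    is replaced by the sum of the [E_(t, t + 1)] over the [t] with [w_t = x].
    Freeness of [F] provides such a representation, and it can be arranged that
    [R] falls so far above the diagonal that [D] acts by [0]
    ([lift_mod_band], [lift_den]).  In this way no model of the free Lie
    superalgebra is needed, and the argument does not depend on the
    characteristic or on the choice of the presentation. *)

Set Implicit Arguments.
Unset Strict Implicit.
Unset Printing Implicit Defensive.
Import GRing.Theory.
Local Open Scope ring_scope.

(** * Brackets of graded subspaces *)

Section SubspaceBrackets.
Variables (K : fieldType) (F : lieSuperalgType K).
Implicit Types (A B C D : gradedSubspace F) (x y z : F).

Lemma gsetN A x : A x -> A (- x).
Proof. by rewrite -scaleN1r; apply: gsetZ. Qed.

Lemma gsetB A x y : A x -> A y -> A (x - y).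
Proof. by move=> Ax /gsetN; apply: gsetD. Qed.

Lemma gset_fsum A (I : finType) (P : pred I) (f : I -> F) :
  (forall i, P i -> A (f i)) -> A (\sum_(i | P i) f i).
Proof.
by move=> Af; elim/big_ind: _ => //; [apply: gset0 | exact: gsetD].
Qed.

Lemma brk_sumr (I : finType) x (f : I -> F) :
  brk x (\sum_i f i) = \sum_i brk x (f i).
Proof. by elim/big_ind2: _ => [|u u' v v' <- <-|//]; rewrite ?brk0r ?brkDr. Qed.

Lemma brk_suml (I : finType) x (f : I -> F) :
  brk (\sum_i f i) x = \sum_i brk (f i) x.
Proof. by elim/big_ind2: _ => [|u u' v v' <- <-|//]; rewrite ?brk0l ?brkDl. Qed.

Lemma brk_parts x y :
  brk x y = \sum_i \sum_j brk (part i x) (part j y).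
Proof.
rewrite -{1}(part_sum x) -{1}(part_sum y) !big_bool /= !(brkDl, brkDr).
by rewrite [RHS]addrC (addrC (brk (part false x) (part true y)))
  (addrC (brk (part true x) (part true y))).
Qed.

Lemma gbrkP A B D : (forall x y, A x -> B y -> D (brk x y)) ->
  forall v, gbrk A B v -> D v.
Proof.
by move=> ABD v [n [a [b [Aa Bb ->]]]]; apply: gset_sum => i; apply: ABD.
Qed.

Lemma gbrkC A B x : gbrk A B x -> gbrk B A x.
Proof.
apply: gbrkP => {}x y Ax By; rewrite brk_parts.
do 2![apply: gset_fsum => ? _].
rewrite (brk_skew _ _ _ _ (part_id _ x) (part_id _ y)).
by apply/gsetN/gsetZ/gbrk_mem; apply: gset_part.
Qed.

(** The three subspaces lemma: since [B] and [C] are graded, the Jacobi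
    identity may be applied to homogeneous components, where it has signs. *)
Lemma gbrk_jacobi A B C D :
  (forall v, gbrk (gbrk A B) C v -> D v) -> (forall v, gbrk (gbrk A C) B v -> D v) ->
  forall x y z, A x -> B y -> C z -> D (brk x (brk y z)).
Proof.
move=> hC hB x y z Ax By Cz.
have h i j : D (brk (part i x) (brk (part j y) z)).
  rewrite (brk_jacobi _ _ _ _ _ (part_id i x) (part_id j y)).
  apply: gsetD; [apply: hC|apply/gsetZ/hB/gbrkC].
    by apply: gbrk_mem => //; apply: gbrk_mem; apply: gset_part.
  by apply: gbrk_mem; [|apply: gbrk_mem => //]; apply: gset_part.
rewrite -(part_sum x) -(part_sum y) !(brkDl, brkDr).
by apply: gsetD; apply: gsetD.
Qed.

Section Denominator.
Variable R : gradedSubspace F.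
Local Notation D := (gbrk (gbrk R gfull) gfull).

Lemma gbrk_fullr r f : R r -> gbrk R gfull (brk f r).
Proof. by move=> Rr; apply/gbrkC/gbrk_mem. Qed.

(** Whatever the position of [r], a double bracket of [r] with two elements
    of [F] lies in [[[R, F], F]]. *)
Lemma den_rff r f g : R r -> D (brk (brk r f) g).
Proof. by move=> Rr; do 2!apply: gbrk_mem => //. Qed.

Lemma den_frf r f g : R r -> D (brk (brk f r) g).
Proof. by move=> Rr; apply: gbrk_mem => //; apply: gbrk_fullr. Qed.

Lemma den_r_ff r f g : R r -> D (brk r (brk f g)).
Proof.
by move=> Rr; apply: (@gbrk_jacobi R gfull gfull) => //.
Qed.

Lemma den_ffr r f g : R r -> D (brk (brk f g) r).
Proof.
move=> Rr; have : gbrk (gbrk gfull gfull) R (brk (brk f g) r).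
  by apply: gbrk_mem => //; apply: gbrk_mem.
move/gbrkC; apply: gbrkP => x _ Rx [n [a [b [_ _ ->]]]].
by rewrite brk_sumr; apply: gset_fsum => i _; apply: den_r_ff.
Qed.

End Denominator.
End SubspaceBrackets.

Section Homs.
Variables (K : fieldType) (L M : lieSuperalgType K) (f : L -> M).
Hypothesis hf : is_lie_hom f.

Lemma homD x y : f (x + y) = f x + f y.
Proof. by case: hf => lf _ _; have := lf 1 x y; rewrite !scale1r. Qed.

Lemma homZ a x : f (a *: x) = a *: f x.
Proof. by case: hf => lf _ _; have := lf a x 0; rewrite !addr0 (lie_hom0 hf) addr0. Qed.

Lemma homB x y : f (x - y) = f x - f y.
Proof. by rewrite -scaleN1r homD homZ scaleN1r. Qed.

Lemma homE x y : f (brk x y) = brk (f x) (f y).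
Proof. by case: hf. Qed.

Lemma hom_part i x : f (part i x) = part i (f x).
Proof. by case: hf. Qed.

Lemma hom_sum (I : finType) (P : pred I) (u : I -> L) :
  f (\sum_(i | P i) u i) = \sum_(i | P i) f (u i).
Proof.
elim/big_ind2: _ => [|u1 u1' v v' <- <-|//]; first exact: lie_hom0 hf.
by rewrite homD.
Qed.
End Homs.

(** * Homogeneous bases *)

Section Coordinates.
Variables (K : fieldType) (Q : lieSuperalgType K) (I : finType).
Variables (deg : I -> bool) (q : I -> Q).
Hypothesis q_deg : forall i, part (deg i) (q i) = q i.
Hypothesis q_span : forall x, exists c : I -> K, x = \sum_i c i *: q i.
Hypothesis q_free : forall c : I -> K, \sum_i c i *: q i = 0 -> forall i, c i = 0.

(** Coordinates along a basis that need not be indexed by an initial segment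
    of the integers.  They are functions of the vector, so that they can be
    used as linear forms. *)
Lemma homogeneous_coordinates : exists c : Q -> I -> K,
  [/\ forall x, x = \sum_i c x i *: q i,
      forall d i, c (\sum_i d i *: q i) i = d i,
      forall a x y i, c (a *: x + y) i = a * c x i + c y i &
      forall p x i, c (part p x) i = if p == deg i then c x i else 0].
Proof.
have [c cP] := choice q_span.
have c_uniq x (d : I -> K) : x = \sum_i d i *: q i -> c x = d.
  move=> xd; apply/funext => i; apply/eqP; rewrite -subr_eq0; apply/eqP.
  move: i; apply: q_free; under eq_bigr do rewrite scalerBl.
  by rewrite sumrB -cP -xd subrr.
exists c; split=> [//|d i|a x y i|p x i]; first by rewrite (c_uniq _ _ erefl).
  rewrite (@c_uniq _ (fun i => a * c x i + c y i)) //.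
  under eq_bigr do rewrite scalerDl -scalerA.
  by rewrite big_split /= -scaler_sumr -!cP.
rewrite (@c_uniq _ (fun i => if p == deg i then c x i else 0)) //.
rewrite [in LHS](cP x) linear_sum; apply: eq_bigr => j _ /=.
by rewrite linearZ /= -[in LHS]q_deg part_part; case: eqP; rewrite ?q_deg ?scale0r ?scaler0.
Qed.

Hypothesis Q_abelian : forall x y : Q, brk x y = 0.

Lemma abelian_iso : lie_isomorphic Q
  (abelian_lie K #|[pred i | ~~ deg i]| #|[pred i | deg i]|).
Proof.
have [c [cP c_sum c_lin c_part]] := homogeneous_coordinates.
pose A0 := [pred i | ~~ deg i]; pose A1 := [pred i | deg i].
pose f x : abelian_lie K #|A0| #|A1| :=
  (\row_j c x (enum_val j), \row_j c x (enum_val j)).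
pose d0 (u : abelian_lie K #|A0| #|A1|) i :=
  \sum_(j < #|A0|) u.1 0 j * (enum_val j == i)%:R.
pose d1 (u : abelian_lie K #|A0| #|A1|) i :=
  \sum_(j < #|A1|) u.2 0 j * (enum_val j == i)%:R.
pose h u := \sum_i (d0 u i + d1 u i) *: q i.
exists f; split; first split.
- by move=> a x y; congr (_, _); apply/rowP => j; rewrite !mxE c_lin.
- move=> i x; rewrite /f /part /= /ab_part; case: i; congr (_, _); apply/rowP => j;
    rewrite !mxE c_part; have := enum_valP j; rewrite !inE.
  + by case: (deg _).
  + by case: (deg _).
  + by case: (deg _).
  + by case: (deg _).
- move=> x y; rewrite Q_abelian; have c0 i : c 0 i = 0.
    by rewrite -(c_sum (fun=> 0) i) big1 // => j _; rewrite scale0r.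
  by congr (_, _); apply/rowP => j; rewrite !mxE c0.
have sum_val (A : {pred I}) (F : 'I_#|A| -> K) (j : 'I_#|A|) :
    \sum_k F k * (enum_val k == enum_val j)%:R = F j.
  rewrite (bigD1 j) //= eqxx mulr1 big1 ?addr0 // => k kj.
  by rewrite (inj_eq enum_val_inj) (negPf kj) mulr0.
have sum_off (A : {pred I}) (F : 'I_#|A| -> K) i : i \notin A ->
    \sum_k F k * (enum_val k == i)%:R = 0.
  move=> iA; rewrite big1 // => k _; case: eqP => [ki|_]; last by rewrite mulr0.
  by move: iA; rewrite -ki enum_valP.
exists h => [x|u].
  rewrite /h [RHS]cP; apply: eq_bigr => i _; congr (_ *: _).
  case: (boolP (deg i)) => di.
    rewrite /d0 sum_off ?inE ?negbK // add0r /d1 /f /=.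
    have Ai : i \in A1 by rewrite inE.
    rewrite -(enum_rankK_in Ai Ai); under eq_bigr do rewrite mxE.
    exact: sum_val.
  rewrite /d1 sum_off ?inE // addr0 /d0 /f /=.
  have Ai : i \in A0 by rewrite inE.
  rewrite -(enum_rankK_in Ai Ai); under eq_bigr do rewrite mxE.
  exact: sum_val.
case: u => u1 u2; rewrite /f.
congr (_, _); apply/rowP => j; rewrite mxE /h c_sum /d0 /d1 /=;
  have := enum_valP j; rewrite inE => dj.
  by rewrite sum_val sum_off ?addr0 // inE.
by rewrite sum_val sum_off ?add0r // inE negbK.
Qed.

End Coordinates.

Section MultiplierIso.
Variables (K : fieldType) (L : lieSuperalgType K) (P : freePresentation L).
Local Notation F := (fp_alg P).
Local Notation R := (gker (fp_hom P)).
Local Notation D := (mult2_den P).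
Variables (I : finType) (deg : I -> bool) (h : I -> F).
Hypothesis h_num : forall i, mult2_num P (h i).
Hypothesis h_deg : forall i, part (deg i) (h i) = h i.
Hypothesis h_span : forall x, mult2_num P x ->
  exists c : I -> K, D (x - \sum_i c i *: h i).
Hypothesis h_free : forall c : I -> K, D (\sum_i c i *: h i) -> forall i, c i = 0.

(** A family of representatives, homogeneous and a basis modulo [D], is all
    that has to be exhibited: the multiplier is abelian, because
    [[R, F^3]] lies in [D]. *)
Lemma multiplier2_iso : lie_isomorphic (multiplier2 P)
  (abelian_lie K #|[pred i | ~~ deg i]| #|[pred i | deg i]|).
Proof.
pose S := subLie (@mult2_num_alg _ _ P).
pose s i : S := SubLie (@mult2_num_alg _ _ P) (asboolT (h_num i)).
pose idD := @mult2_den_in_ideal _ _ P.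
pose pi : S -> multiplier2 P := quot_pi idD.
have piH : is_lie_hom pi := quot_pi_hom idD.
have valH : is_lie_hom (val : S -> F) := subLie_val_hom _.
have pi_sum c : pi (\sum_i c i *: s i) = \sum_i c i *: pi (s i).
  by rewrite (hom_sum piH); apply: eq_bigr => i _; rewrite (homZ piH).
have val_sum c : val (\sum_i c i *: s i) = \sum_i c i *: h i.
  by rewrite (hom_sum valH); apply: eq_bigr => i _; rewrite (homZ valH).
have pi0 (u : S) : pi u = 0 <-> D (val u).
  by rewrite -(quot_pi0 idD) (quot_piP idD) subr0.
apply: (@abelian_iso _ _ _ deg (fun i => pi (s i))).
- by move=> i; rewrite -(hom_part piH); congr pi; apply: val_inj; rewrite /= h_deg.
- elim/quot_ind => x; have [c cP] := h_span (subLieP x); exists c.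
  rewrite -pi_sum; apply/(quot_piP idD).
  by rewrite /mult2_den_in /= -val_sum -(homB valH) in cP *.
- by move=> c; rewrite -pi_sum => /pi0; rewrite val_sum; apply: h_free.
- elim/quot_ind => x; elim/quot_ind => y; rewrite -(homE piH); apply/pi0.
  have -> : val (brk x y) = brk (val x) (val y) by [].
  have [Rx _] := subLieP x; have [_] := subLieP y.
  case=> n [a [b [_ _ ->]]].
  by rewrite brk_sumr; apply: gset_fsum => i _; apply: den_r_ff.
Qed.

End MultiplierIso.

(** * Matrices as a Lie superalgebra *)

(** The matrices of the superspace whose [i]-th basis vector has parity [g i].
    The parity [g] occurs only in the type, where the bracket reads it. *)
Definition glmx (K : fieldType) (N : nat) (g : 'I_N -> bool) : Type := 'M[K]_N.

Section GeneralLinear.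
Variables (K : fieldType) (N : nat) (g : 'I_N -> bool).

Implicit Types X Y Z : 'M[K]_N.

Definition gl_part (p : bool) X : 'M[K]_N :=
  \matrix_(i, j) (if g i (+) g j == p then X i j else 0).

(** The supercommutator [XY - (-1)^(|X||Y|) YX], made additive: the sign only
    affects the product of the odd components. *)
Definition gl_brk X Y : 'M[K]_N :=
  X *m Y - Y *m X + (gl_part true Y *m gl_part true X) *+ 2.

Lemma gl_part_linear p : linear (gl_part p).
Proof.
by move=> a X Y; apply/matrixP=> i j; rewrite !mxE; case: eqP; rewrite ?mulr0 ?addr0.
Qed.

HB.instance Definition _ p := GRing.isLinear.Build K 'M[K]_N 'M[K]_N *:%R
  (gl_part p) (gl_part_linear p).

Lemma gl_part_sum X : gl_part false X + gl_part true X = X.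
Proof. by apply/matrixP=> i j; rewrite !mxE; case: (_ (+) _); rewrite /= ?add0r ?addr0. Qed.

Lemma gl_part_part p q X :
  gl_part p (gl_part q X) = if p == q then gl_part q X else 0.
Proof.
by case: eqP => [->|/eqP pq]; apply/matrixP=> i j; rewrite !mxE;
  case: eqP => // ->; rewrite ?(negPf pq).
Qed.

Lemma gl_brk_linearl Y : linear (fun X => gl_brk X Y).
Proof.
move=> a X X'; rewrite /gl_brk gl_part_linear mulmxDl !mulmxDr -!scalemxAl -!scalemxAr.
apply/matrixP=> i j; rewrite !mxE; ring.
Qed.

Lemma gl_brk_linearr X : linear (gl_brk X).
Proof.
move=> a Y Y'; rewrite /gl_brk gl_part_linear !mulmxDl !mulmxDr -!scalemxAl -!scalemxAr.
apply/matrixP=> i j; rewrite !mxE; ring.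
Qed.

Lemma gl_part_mul p q X Y : gl_part p X = X -> gl_part q Y = Y ->
  gl_part (p (+) q) (X *m Y) = X *m Y.
Proof.
move=> pX qY; apply/matrixP=> i j; rewrite !mxE; case: eqP => // ne.
apply/esym/big1 => k _; rewrite -pX -qY !mxE.
case: eqP => [e1|_]; last by rewrite mul0r.
case: eqP => [e2|_]; last by rewrite mulr0.
by case: ne; rewrite -e1 -e2; case: (g i); case: (g j); case: (g k).
Qed.

Lemma gl_brkE p q X Y : gl_part p X = X -> gl_part q Y = Y ->
  gl_brk X Y = X *m Y - (-1) ^+ (p && q) *: (Y *m X).
Proof.
rewrite /gl_brk => <- <-; rewrite !gl_part_part.
case: p; case: q; rewrite /= ?mulmx0 ?mul0mx ?mul0rn ?addr0 ?expr1 ?expr0 ?scale1r //.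
by rewrite scaleN1r opprK mulr2n addrA subrK.
Qed.

Lemma gl_brk_part p q X Y : gl_part p X = X -> gl_part q Y = Y ->
  gl_part (p (+) q) (gl_brk X Y) = gl_brk X Y.
Proof.
move=> pX qY; rewrite (gl_brkE pX qY) linearB linearZ /= (gl_part_mul pX qY).
by rewrite addbC (gl_part_mul qY pX).
Qed.

Lemma gl_brk_skew p q X Y : gl_part p X = X -> gl_part q Y = Y ->
  gl_brk X Y = - ((-1) ^+ (p && q) *: gl_brk Y X).
Proof.
move=> pX qY; rewrite (gl_brkE pX qY) (gl_brkE qY pX) andbC.
rewrite scalerBr scalerA -signr_addb addbb expr0 scale1r opprB.
by rewrite addrC.
Qed.

Lemma gl_brk_jacobi p q X Y Z : gl_part p X = X -> gl_part q Y = Y ->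
  gl_brk X (gl_brk Y Z) =
  gl_brk (gl_brk X Y) Z + (-1) ^+ (p && q) *: gl_brk Y (gl_brk X Z).
Proof.
move=> pX qY.
have brD U A B : gl_brk U (A + B) = gl_brk U A + gl_brk U B.
  by have := gl_brk_linearr U 1 A B; rewrite !scale1r.
suff hom r T : gl_part r T = T -> gl_brk X (gl_brk Y T) =
    gl_brk (gl_brk X Y) T + (-1) ^+ (p && q) *: gl_brk Y (gl_brk X T).
  rewrite -(gl_part_sum Z); set Z0 := gl_part false Z; set Z1 := gl_part true Z.
  rewrite !(brD _ Z0 Z1) (brD X (gl_brk Y Z0)) (brD Y (gl_brk X Z0)) scalerDr.
  by rewrite (hom false) ?(hom true) ?gl_part_part // addrACA.
move=> rT.
rewrite (gl_brkE pX (gl_brk_part qY rT)) (gl_brkE (gl_brk_part pX qY) rT).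
rewrite (gl_brkE qY (gl_brk_part pX rT)) (gl_brkE pX qY) (gl_brkE pX rT).
rewrite (gl_brkE qY rT) !(mulmxBl, mulmxBr) -!scalemxAl -!scalemxAr !mulmxA.
by apply/matrixP=> i j; case: {pX} p; case: {qY} q; case: {rT} r;
  rewrite !mxE /=; ring.
Qed.

Lemma gl_brk_even X : gl_part false X = X -> gl_brk X X = 0.
Proof. by move=> X0; rewrite (gl_brkE X0 X0) expr0 scale1r subrr. Qed.

Lemma gl_brk_odd X : gl_part true X = X -> gl_brk X (gl_brk X X) = 0.
Proof.
move=> X1; rewrite (gl_brkE X1 (gl_brk_part X1 X1)) (gl_brkE X1 X1) /=.
by rewrite expr0 expr1 scale1r scaleN1r opprK mulmxDl mulmxDr mulmxA subrr.
Qed.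

HB.instance Definition _ := GRing.Lmodule.on (glmx K g).

HB.instance Definition _ := Lmodule_isLieSuperalgebra.Build K (glmx K g)
  gl_part_linear gl_part_sum gl_part_part gl_brk_linearl gl_brk_linearr
  gl_brk_part gl_brk_skew gl_brk_jacobi gl_brk_even gl_brk_odd.

(** The filtration by distance to the diagonal plays the part of the lower
    central series: it is multiplicative, and vanishes after [N] steps. *)
Definition band (s : nat) (X : glmx K g) : Prop :=
  forall i j : 'I_N, (j < i + s)%N -> X i j = 0.

Lemma band0 s : band s (0 : glmx K g). Proof. by move=> i j _; rewrite mxE. Qed.

Lemma band_linear s a (X Y : glmx K g) : band s X -> band s Y -> band s (a *: X + Y).
Proof. by move=> bX bY i j h; rewrite !mxE bX // bY // mulr0 addr0. Qed.

Lemma band_part s p (X : glmx K g) : band s X -> band s (part p X).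
Proof. by move=> bX i j h; rewrite !mxE bX //; case: ifP. Qed.

Definition gband s : gradedSubspace (glmx K g) :=
  @GradedSubspace K (glmx K g) (band s) (@band0 s) (@band_linear s) (@band_part s).

Lemma band_mul s t (X Y : glmx K g) : band s X -> band t Y -> band (s + t) (X *m Y).
Proof.
move=> bX bY i j h; rewrite mxE big1 // => k _.
case: (ltnP k (i + s)) => hk; first by rewrite bX // mul0r.
by rewrite bY ?mulr0 //; lia.
Qed.

Lemma band_brk s t (X Y : glmx K g) : band s X -> band t Y -> band (s + t) (brk X Y).
Proof.
move=> bX bY; have bD := @gsetD _ _ (gband (s + t)); have bZ := @gsetZ _ _ (gband (s + t)).
rewrite /brk /= /gl_brk -scaler_nat -[- _]scaleN1r.
apply: (bD); [apply: (bD)|]; [exact: band_mul| |]; apply: (bZ); rewrite addnC.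
  exact: band_mul.
by apply: band_mul; apply: band_part.
Qed.

Lemma bandW s t (X : glmx K g) : (s <= t)%N -> band t X -> band s X.
Proof. by move=> st bX i j h; apply: bX; lia. Qed.

End GeneralLinear.
Arguments gband {K N} g s.
Arguments band0 {K N g} s.

Section BandEntries.
Variables (K : fieldType) (N : nat) (g : 'I_N -> bool).
Implicit Types (A B C : glmx K g) (i j k : 'I_N).

(** On the lowest diagonal where it may be nonzero, a product of two banded
    matrices has entries that are monomials. *)
Lemma band_mul_entry s t A B i j k : band s A -> band t B ->
  k = (i + s)%N :> nat -> j = (k + t)%N :> nat -> (A *m B) i j = A i k * B k j.
Proof.
move=> bA bB ki jk; rewrite mxE (bigD1 k) //= big1 ?addr0 // => k' /eqP kk'.
have [lt|] := ltnP k' (i + s); first by rewrite bA // mul0r.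
rewrite -ki leq_eqVlt => /predU1P[/val_inj kk|lt]; first by case: kk'.
by rewrite bB ?mulr0 // jk ltn_add2r.
Qed.

Lemma band_brk_entry s t p q A B i j k k' : band s A -> band t B ->
  part p A = A -> part q B = B ->
  k = (i + s)%N :> nat -> j = (k + t)%N :> nat -> k' = (i + t)%N :> nat ->
  brk A B i j = A i k * B k j - (-1) ^+ (p && q) * (B i k' * A k' j).
Proof.
move=> bA bB pA qB ki jk k'i.
have -> : brk A B = A *m B - (-1) ^+ (p && q) *: (B *m A) := gl_brkE pA qB.
rewrite -(band_mul_entry bA bB ki jk) -(band_mul_entry bB bA k'i).
  by rewrite [LHS]mxE [X in _ + X]mxE [X in _ - X]mxE.
by rewrite jk ki k'i addnAC.
Qed.
End BandEntries.

Section Superdiagonal.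
Variables (K : fieldType) (L : lieSuperalgType K) (N : nat).
Variables (chi : nat -> L -> K) (par : nat -> bool).
Hypothesis chi_linear : forall t a x y, chi t (a *: x + y) = a * chi t x + chi t y.
Hypothesis chi_part : forall t p x, chi t (part p x) = if p == par t then chi t x else 0.

(** With this grading of the rows, the entry [(t, t + 1)] has parity [par t]. *)
Definition prefix_parity (i : 'I_N) : bool := \big[addb/false]_(t < i) par t.
Local Notation gl := (glmx K prefix_parity).

(** The generic element of the representation that reads off the coefficient of
    a word, the [t]-th letter of which is tested by the linear form [chi t]. *)
Definition superdiag (x : L) : gl :=
  \matrix_(i, j) (if j == i.+1 :> nat then chi i x else 0).

Lemma superdiag_linear : linear superdiag.
Proof.
by move=> a x y; apply/matrixP=> i j; rewrite !mxE; case: ifP; rewrite ?chi_linear ?mulr0 ?addr0.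
Qed.

Lemma superdiag_part p x : superdiag (part p x) = part p (superdiag x).
Proof.
apply/matrixP=> i j; rewrite !mxE; case: eqP => [ij|]; last by case: ifP.
rewrite chi_part /prefix_parity ij big_ord_recr /= addbA addbb addFb eq_sym.
by case: eqP.
Qed.

Lemma superdiag_band x : band 1 (superdiag x).
Proof. by move=> i j; rewrite addn1 mxE; case: eqP => // ->; rewrite ltnn. Qed.

Lemma superdiagE x (i j : 'I_N) : j = i.+1 :> nat -> superdiag x i j = chi i x.
Proof. by move=> ij; rewrite mxE ij eqxx. Qed.

End Superdiagonal.

(** * Homomorphisms out of a free presentation *)

Section Free.
Variables (K : fieldType) (F : lieSuperalgType K) (X : Type) (deg : X -> bool).
Variables (iota : X -> F).
Hypothesis freeF : is_free_lie deg iota.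

(** The retraction of [F] onto a subalgebra containing the generators is, by
    uniqueness, the identity. *)
Lemma free_ind (A : gradedSubspace F) :
  is_subalgebra A -> (forall x, A (iota x)) -> forall f, A f.
Proof.
case: freeF => degi univ algA Ai f.
pose h x : subLie algA := SubLie algA (asboolT (Ai x)).
have hdeg x : part (deg x) (h x) = h x.
  by apply: val_inj; rewrite /= degi.
have [phi [phiH phih _]] := univ _ h hdeg.
have [idF [_ _ uniq]] := univ F iota degi.
have -> : f = val (phi f).
  rewrite (uniq (fun f => val (phi f))) => [||x]; last by rewrite phih.
    by apply: (uniq id).
  by split=> [a x y|i x|x y]; case: phiH => h1 h2 h3; rewrite ?h1 ?h2 ?h3 //= linearP.
exact: subLieP.
Qed.

End Free.

Section Lift.
Variables (K : fieldType) (L : lieSuperalgType K) (P : freePresentation L).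
Local Notation F := (fp_alg P).
Local Notation pi := (@fp_map _ _ P).
Local Notation R := (gker (fp_hom P)).
Variables (N : nat) (g : 'I_N -> bool) (psi : L -> glmx K g) (s : nat).
Hypothesis s_gt0 : (0 < s)%N.
Hypothesis psi_linear : linear psi.
Hypothesis psi_part : forall i x, psi (part i x) = part i (psi x).
Hypothesis psi1 : forall x, band 1 (psi x).
Hypothesis psi_brk : forall x y, band s (psi (brk x y) - brk (psi x) (psi y)).

(** A linear map [psi] defined on [L] is made into a homomorphism on [F] by
    prescribing it on the generators.  The two agree modulo [band s] as soon as
    [psi] itself preserves brackets modulo [band s], because this agreement
    defines a subalgebra. *)
Lemma lift_mod_band : exists phi : F -> glmx K g,
  is_lie_hom phi /\ forall f, band s (phi f - psi (pi f)).
Proof.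
have psi0 : psi 0 = 0.
  by have := psi_linear (-1) 0 0; rewrite scaler0 addr0 scaleN1r addNr.
have [degi univ] := fp_free P.
have [|phi [phiH phii _]] := univ _ (fun x => psi (pi (fp_iota x))).
  by move=> x; rewrite -psi_part -(hom_part (fp_hom P)) degi.
exists phi; split=> //.
have A0 : band s (phi 0 - psi (pi 0)).
  by rewrite (lie_hom0 (fp_hom P)) (lie_hom0 phiH) psi0 subr0; apply: band0.
have Alin a x y : band s (phi x - psi (pi x)) -> band s (phi y - psi (pi y)) ->
    band s (phi (a *: x + y) - psi (pi (a *: x + y))).
  move=> bx by_; have [lf _ _] := phiH; have [lp _ _] := fp_hom P.
  rewrite lf lp psi_linear opprD addrACA -scalerBr.
  exact: (@gset_linear _ _ (gband g s)).
have Apart i x : band s (phi x - psi (pi x)) -> 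
    band s (phi (part i x) - psi (pi (part i x))).
  rewrite (hom_part phiH) (hom_part (fp_hom P)) psi_part -linearB.
  exact: band_part.
apply: (@free_ind _ _ _ _ _ (fp_free P) (GradedSubspace A0 Alin Apart)); last first.
  by move=> x /=; rewrite phii subrr; apply: band0.
move=> x y /= bx by_; rewrite (homE phiH) (homE (fp_hom P)).
set u := pi x in bx *; set v := pi y in by_ *.
have bphi : band 1 (phi y).
  rewrite -(subrK (psi v) (phi y)).
  by apply: (@gsetD _ _ (gband g 1)); [apply: bandW by_ | apply: psi1].
have -> : brk (phi x) (phi y) - psi (brk u v) =
  brk (phi x - psi u) (phi y) + brk (psi u) (phi y - psi v)
  - (psi (brk u v) - brk (psi u) (psi v)).
  rewrite brkDl [brk (psi u) (_ - _)]brkDr brkNl brkNr addrA subrK opprB.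
  by rewrite addrA subrK.
apply: (@gsetB _ _ (gband g s)) (psi_brk u v).
apply: (@gsetD _ _ (gband g s)).
  by apply: bandW (band_brk bx bphi); rewrite leq_addr.
by apply: bandW (band_brk (psi1 u) by_); rewrite leq_addl.
Qed.

(** Elements of [R] are sent to [band s], since [psi] vanishes on their image,
    and each bracket moves one step further from the diagonal. *)
Lemma lift_den (phi : F -> glmx K g) : is_lie_hom phi ->
  (forall f, band s (phi f - psi (pi f))) ->
  (forall f, band 1 (phi f)) /\
  (forall f, gbrk (gbrk R gfull) gfull f -> band s.+2 (phi f)).
Proof.
move=> phiH bphi.
have b1 f : band 1 (phi f).
  rewrite -(subrK (psi (pi f)) (phi f)).
  by apply: (@gsetD _ _ (gband g 1)); [apply: bandW (bphi f) | apply: psi1].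
have bR f : R f -> band s (phi f).
  move=> /= Rf; have := bphi f; rewrite Rf.
  suff -> : psi 0 = 0 by rewrite subr0.
  by have := psi_linear (-1) 0 0; rewrite scaler0 addr0 scaleN1r addNr.
split=> //; rewrite -addn2; apply: (gbrkP (D := gpreim phiH (gband g (s + 2)))) => x y.
case=> n [a [b [Ra _ ->]]] _; rewrite /= (homE phiH) (hom_sum phiH) brk_suml.
apply: (@gset_fsum _ _ (gband g (s + 2))) => i _.
by rewrite (homE phiH) (addnA s 1 1); do 2![apply: band_brk => //]; apply: bR.
Qed.

End Lift.

(** * Counting the brackets of degree three *)

Section HallCount.
Local Open Scope nat_scope.
Variables m l : nat.
Local Notation n := (m + l).

Definition odd_index (i : nat) : bool := m <= i.

(** [(i, j, k)] stands for the bracket [[[v_i, v_j], v_k]]; the condition is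
    that of the Hall basis in degree three. *)
Definition hall (t : 'I_n * 'I_n * 'I_n) : bool :=
  (t.1.2 < t.1.1) && (t.1.2 <= t.2).

Definition tri_deg (t : 'I_n * 'I_n * 'I_n) : bool :=
  odd_index t.1.1 (+) odd_index t.1.2 (+) odd_index t.2.

Lemma count_ge j p : \sum_(i < p) (j <= i : nat) = p - j.
Proof.
elim: p => [|p IHp]; first by rewrite big_ord0.
by rewrite big_ord_recr /= IHp; case: leqP; lia.
Qed.

Definition count_index (j : nat) (b : bool) := if b then m + l - maxn j m else m - j.

Arguments count_index : simpl never.

Lemma count_from j b :
  \sum_(i < n) ((j <= i) && (odd_index i == b) : nat) = count_index j b.
Proof.
rewrite big_split_ord /= /odd_index /count_index; case: b.
  rewrite big1 ?add0n => [|i _]; last first.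
    by have := ltn_ord i; rewrite (leqNgt m) /= => ->; rewrite andbF.
  rewrite (eq_bigr (fun i : 'I_l => (j - m <= i) : nat)); last first.
    by move=> i _; rewrite leq_addr andbT leq_subLR.
  by rewrite count_ge; lia.
rewrite [X in _ + X]big1 ?addn0 => [|i _]; last by rewrite leq_addr andbF.
rewrite -count_ge; apply: eq_bigr => i _.
by rewrite [X in _ && X](_ : _ = true) ?andbT //; have := ltn_ord i; rewrite (leqNgt m) /= => ->.
Qed.

(** The middle index [j] is the least of the three, and the other two can be
    chosen independently once their parities are fixed. *)
Lemma card_hall_sum b :
  #|[pred t : {t | hall t} | tri_deg (val t) == b]| =
  \sum_(j < n) (count_index j.+1 false * count_index j (odd_index j (+) b)
                + count_index j.+1 true * count_index j (~~ (odd_index j (+) b))).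
Proof.
have -> : #|[pred t : {t | hall t} | tri_deg (val t) == b]| =
    #|[pred t | hall t && (tri_deg t == b)]|.
  rewrite -(card_image val_inj); apply: eq_card => t; rewrite !inE.
  apply/imageP/andP => [[u]|[ht dt]]; first by rewrite inE => ut ->; rewrite (valP u).
  by exists (Sub t ht).
rewrite -sum1_card big_mkcond /=.
transitivity (\sum_i \sum_j \sum_k (hall (i, j, k) && (tri_deg (i, j, k) == b) : nat)).
  rewrite [RHS]pair_bigA [RHS]pair_bigA /=; apply: eq_bigr => -[[i j] k] _ /=.
  by rewrite inE; case: (_ && _).
rewrite exchange_big; apply: eq_bigr => j _ /=.
transitivity (\sum_(i < n) ((j < i) * count_index j (odd_index i (+) odd_index j (+) b))).
  apply: eq_bigr => i _; rewrite -count_from big_distrr /=; apply: eq_bigr => k _.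
  rewrite /hall /tri_deg /=; case: (j < i) => //=; rewrite mul1n; congr (_ && _ : nat).
  by case: (odd_index i); case: (odd_index j); case: (odd_index k); case: b.
rewrite -(count_from j.+1 false) -(count_from j.+1 true) !big_distrl -big_split /=.
apply: eq_bigr => i _.
case: (j < i) => //=; rewrite mul1n.
by case: (odd_index i); rewrite ?mul0n ?mul1n ?addn0 ?add0n // addTb addNb.
Qed.

Lemma sum_tetra p : 3 * (\sum_(j < p) (p - j.+1) * (p - j)) + p = p ^ 3.
Proof.
elim: p => [|p IHp]; first by rewrite big_ord0.
rewrite big_ord_recl subSS !subn0 mulnDr -addnA addnS.
under eq_bigr do rewrite lift0 !subSS.
rewrite IHp; ring.
Qed.

Lemma sum_odds p : \sum_(j < p) ((p - j.+1) + (p - j)) = p ^ 2.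
Proof.
elim: p => [|p IHp]; first by rewrite big_ord0.
rewrite big_ord_recl subSS !subn0.
under eq_bigr do rewrite lift0 !subSS.
rewrite IHp; ring.
Qed.

Lemma card_hall_even :
  3 * #|[pred t : {t | hall t} | ~~ tri_deg (val t)]| + m = m ^ 3 + 3 * (m * l ^ 2).
Proof.
rewrite (eq_card (B := [pred t : {t | hall t} | tri_deg (val t) == false])); last first.
  by move=> t; rewrite !inE eqbF_neg.
rewrite card_hall_sum big_split_ord /= (eq_bigr (fun j : 'I_m =>
    (m - j.+1) * (m - j) + l ^ 2)) => [|j _]; last first.
  have jm := ltn_ord j; rewrite /odd_index leqNgt jm /= /count_index.
  by rewrite (maxn_idPr jm) (maxn_idPr (ltnW jm)) addKn.
rewrite [X in 3 * (_ + X)]big1 ?addn0 => [|j _]; last first.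
  rewrite /odd_index leq_addr /= /count_index.
  have -> : m - (m + j).+1 = 0 by lia.
  have -> : m - (m + j) = 0 by lia.
  by rewrite muln0.
rewrite big_split /= sum_nat_const card_ord mulnDr.
by rewrite addnAC sum_tetra.
Qed.

Lemma card_hall_odd :
  3 * #|[pred t : {t | hall t} | tri_deg (val t)]| + l = l ^ 3 + 3 * (l * m ^ 2).
Proof.
rewrite (eq_card (B := [pred t : {t | hall t} | tri_deg (val t) == true])); last first.
  by move=> t; rewrite !inE eqb_id.
rewrite card_hall_sum big_split_ord /= (eq_bigr (fun j : 'I_m =>
    l * ((m - j.+1) + (m - j)))) => [|j _]; last first.
  have jm := ltn_ord j; rewrite /odd_index leqNgt jm /= /count_index.
  by rewrite (maxn_idPr jm) (maxn_idPr (ltnW jm)) addKn mulnDr (mulnC _ l).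
rewrite -big_distrr /= sum_odds (eq_bigr (fun j : 'I_l =>
    (l - j.+1) * (l - j))) => [|j _]; last first.
  rewrite /odd_index leq_addr /= /count_index.
  have -> : m - (m + j).+1 = 0 by lia.
  by congr (_ * _); lia.
by rewrite mulnDr -addnA sum_tetra addnC.
Qed.

End HallCount.

(** * Lie superalgebras with one-dimensional derived subalgebra *)

Section Structure.
Variables (K : fieldType) (L : lieSuperalgType K) (k l : nat).
Hypothesis Ldim : has_sdim (gfull : gradedSubspace L) k l.
Hypothesis L2dim : has_sdim (lcs L 2) 1 0.

Lemma derived_line : exists z : L,
  [/\ part false z = z, z != 0, lcs L 2 z & forall x, lcs L 2 x -> exists a, x = a *: z].
Proof.
have [[e [eP e_free]] [e' [e'P _]]] := L2dim; exists (e ord0).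
have [ez1 ez2] : lcs L 2 (e ord0) /\ part false (e ord0) = e ord0.
  by apply/eP; exists (fun=> 1); rewrite big_ord1 scale1r.
split=> // [|x L2x].
  apply/eqP => e0; have := e_free (fun=> 1); rewrite big_ord1 e0 scaler0.
  by move=> /(_ erefl ord0)/eqP; rewrite oner_eq0.
have /eP[c ec] : lcs L 2 (part false x) /\ part false (part false x) = part false x.
  by split; [exact: gset_part | exact: part_id].
have /e'P[c' ec'] : lcs L 2 (part true x) /\ part true (part true x) = part true x.
  by split; [exact: gset_part | exact: part_id].
by exists (c ord0); rewrite -(part_sum x) ec ec' big_ord1 big_ord0 addr0.
Qed.

(** If [[z, x]] were a nonzero multiple of [z], then [z] would lie in all the
    terms of the lower central series.  For odd [x] the bracket is odd, hence
    zero. *)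
Lemma derived_central (Lnil : nilpotent_lie L) z : part false z = z -> z != 0 ->
  lcs L 2 z -> (forall x, lcs L 2 x -> exists a, x = a *: z) ->
  forall x, brk z x = 0.
Proof.
move=> z0 zn0 L2z L2span.
have sub x : lcs L 2 (brk z x) by apply: gbrk_mem.
have even x : part false x = x -> brk z x = 0.
  move=> x0; have [a za] := L2span _ (sub x); rewrite za.
  case: (eqVneq a 0) => [->|an0]; first by rewrite scale0r.
  have [N LN] := Lnil; have : lcs L N z.
    rewrite /lcs; elim: N.-1 => [|N' IH] //=.
    rewrite -[z](scalerK an0) -za -brkZl.
    by apply: gbrk_mem => //; apply: gsetZ.
  by move/LN/eqP; rewrite (negPf zn0).
move=> x; rewrite -(part_sum x) brkDr even ?part_id // add0r.
have [a za] := L2span _ (sub (part true x)).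
have := brk_part _ _ _ _ z0 (part_id true x); rewrite {}za linearZ /= -z0 part_part /=.
by rewrite scaler0 => <-.
Qed.

(** The exchange lemma: [z] replaces an even basis vector on which it has a
    nonzero coordinate.  Even indices come first. *)
Lemma adapted_coordinates z : part false z = z -> z != 0 ->
  exists m, k = m.+1 /\
  exists (b : 'I_(m + l) -> L) (X : 'I_(m + l) -> L -> K) (gam : L -> K),
  [/\ forall i : 'I_(m + l), part (odd_index m i) (b i) = b i,
      forall x, x = \sum_i X i x *: b i + gam x *: z,
      [/\ forall i a x y, X i (a *: x + y) = a * X i x + X i y,
          forall (i : 'I_(m + l)) p x, X i (part p x) = if p == odd_index m i then X i x else 0,
          forall i j, X i (b j) = (j == i)%:R & forall i, X i z = 0] &
      [/\ forall a x y, gam (a *: x + y) = a * gam x + gam y,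
          forall p x, gam (part p x) = if p then 0 else gam x & gam z = 1]].
Proof.
move=> z0 zn0; have [[e0 [e0P e0_free]] [e1 [e1P e1_free]]] := Ldim.
have [c zc] : exists c : 'I_k -> K, z = \sum_i c i *: e0 i by apply/e0P.
have [i0 ci0] : exists i0, c i0 != 0.
  apply: contrapT => /forallNP h; case/eqP: zn0; rewrite zc big1 // => i _.
  by have /negP/negPn/eqP -> := h i; rewrite scale0r.
have e0_deg i : part false (e0 i) = e0 i.
  suff /e0P[] : exists d : 'I_k -> K, e0 i = \sum_j d j *: e0 j by [].
  exists (fun j => (j == i)%:R); rewrite (bigD1 i) //= eqxx scale1r big1 ?addr0 //.
  by move=> j /negPf->; rewrite scale0r.
have e1_deg i : part true (e1 i) = e1 i.
  suff /e1P[] : exists d : 'I_l -> K, e1 i = \sum_j d j *: e1 j by [].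
  exists (fun j => (j == i)%:R); rewrite (bigD1 i) //= eqxx scale1r big1 ?addr0 //.
  by move=> j /negPf->; rewrite scale0r.
case: k i0 e0 {e0P}(e0P) e0_free c zc ci0 e0_deg => [[]//|m] i0 e0 e0P e0_free c zc ci0 e0_deg.
exists m; split=> //.
pose b (i : 'I_(m + l)) := match split i with inl j => e0 (lift i0 j) | inr j => e1 j end.
have b_l j : b (lshift l j) = e0 (lift i0 j) by rewrite /b (unsplitK (inl j : 'I_m + 'I_l)).
have b_r j : b (rshift m j) = e1 j by rewrite /b (unsplitK (inr j : 'I_m + 'I_l)).
have b_deg (i : 'I_(m + l)) : part (odd_index m i) (b i) = b i.
  rewrite /b /odd_index; case: split_ordP => j ->; last by rewrite leq_addr.
  by have := ltn_ord j; rewrite (leqNgt m) /= => ->.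
pose q (t : 'I_(m + l) + 'I_1) := match t with inl i => b i | inr _ => z end.
pose dq (t : 'I_(m + l) + 'I_1) := match t with inl i => odd_index m i | inr _ => false end.
have q_sum d : \sum_t d t *: q t = \sum_i d (inl i) *: b i + d (inr ord0) *: z.
  by rewrite big_sumType big_ord1.
have zE : z = c i0 *: e0 i0 + \sum_j c (lift i0 j) *: e0 (lift i0 j).
  by rewrite {1}zc (bigD1_ord i0).
have q_deg t : part (dq t) (q t) = q t by case: t => [i|_] /=.
have q_span x : exists d, x = \sum_t d t *: q t.
  have /e0P[d0 xd0] : True /\ part false (part false x) = part false x.
    by split=> //; apply: part_id.
  have /e1P[d1 xd1] : True /\ part true (part true x) = part true x.
    by split=> //; apply: part_id.
  (* The coefficient of [z]: it must account for the whole component along [e0 i0]. *)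
  pose a := d0 i0 / c i0.
  exists (fun t => match t with
    inl i => match split i with inl j => d0 (lift i0 j) - a * c (lift i0 j)
                           | inr j => d1 j end
    | inr _ => a end).
  rewrite q_sum /= big_split_ord /= -[in LHS](part_sum x) xd0 xd1.
  rewrite (bigD1_ord i0) //= [RHS]addrAC; congr (_ + _); last first.
    by apply: eq_bigr => j _; rewrite (unsplitK (inr j : 'I_m + 'I_l)) b_r.
  rewrite zE scalerDr scalerA /a divfK // addrCA; congr (_ + _).
  rewrite scaler_sumr -big_split /=; apply: eq_bigr => j _.
  by rewrite (unsplitK (inl j : 'I_m + 'I_l)) b_l scalerA -scalerDl subrK.
have q_free d : \sum_t d t *: q t = 0 -> forall t, d t = 0.
  rewrite q_sum big_split_ord /= => h.
  have evz : part true z = 0 by rewrite -z0 part_part.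
  have h1 : \sum_j d (inl (rshift m j)) *: e1 j = 0.
    have part0 := congr1 (part true) h; rewrite linear0 !linearD /= in part0.
    rewrite (linearZ _ z) /= evz scaler0 addr0 !linear_sum in part0.
    rewrite -[RHS]part0 [X in _ = X + _]big1 ?add0r => [|j _]; last first.
      by rewrite b_l linearZ /= -e0_deg part_part scaler0.
    by apply: eq_bigr => j _; rewrite b_r linearZ /= e1_deg.
  have d1 := e1_free _ h1.
  move: h; rewrite [X in _ + X + _]big1 ?addr0 => [|j _]; last by rewrite d1 scale0r.
  rewrite {1}zE scalerDr scalerA addrCA scaler_sumr -big_split /= => h.
  pose u i := match unlift i0 i with
    Some j => d (inl (lshift l j)) + d (inr ord0) * c i | None => d (inr ord0) * c i end.
  have u0 : forall i, u i = 0.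
    apply: e0_free; rewrite (bigD1_ord i0) //= /u unlift_none -[RHS]h; congr (_ + _).
    by apply: eq_bigr => j _; rewrite liftK b_l scalerDl scalerA.
  have g0 : d (inr ord0) = 0.
    have := u0 i0; rewrite /u unlift_none => /eqP.
    by rewrite mulf_eq0 (negPf ci0) orbF => /eqP.
  case=> i; last by rewrite ord1.
  case: (split_ordP i) => j ->; last exact: d1.
  by have := u0 (lift i0 j); rewrite /u liftK g0 mul0r addr0.
have [co [coP co_sum co_lin co_part]] := homogeneous_coordinates q_deg q_span q_free.
have co_q t t' : co (q t) t' = (t == t')%:R.
  rewrite -(co_sum (fun t' => (t == t')%:R) t'); congr (co _ _).
  rewrite (bigD1 t) //= eqxx scale1r big1 ?addr0 // => t'' ht.
  by rewrite eq_sym (negPf ht) scale0r.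
exists b, (fun i x => co x (inl i)), (fun x => co x (inr ord0)); split=> //.
- by move=> x; rewrite [LHS]coP q_sum.
- split=> [i a x y|i p x|i j|i]; rewrite ?co_lin ?co_part //.
    exact: (co_q (inl j) (inl i)).
  exact: (co_q (inr ord0) (inl i)).
- split=> [a x y|p x|]; rewrite ?co_lin ?co_part //=; first by case: p.
  exact: (co_q (inr ord0) (inr ord0)).
Qed.

End Structure.

(** * Spanning the third term of the lower central series *)

Section HomogeneousTriples.
Variables (K : fieldType) (F : lieSuperalgType K).
Implicit Types x y z : F.

Lemma brk_skew_even x f : part false x = x -> brk f x = - brk x f.
Proof.
move=> x0; rewrite -(part_sum f) brkDl brkDr opprD.
by congr (_ + _); rewrite (brk_skew _ _ _ _ (part_id _ f) x0) andbF expr0 scale1r.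
Qed.

Lemma brk_skew_scale i j x y : part i x = x -> part j y = y ->
  exists a : K, brk x y = a *: brk y x.
Proof.
by move=> ix jy; exists (- (-1) ^+ (i && j)); rewrite (brk_skew _ _ _ _ ix jy) scaleNr.
Qed.

(** Signs are irrelevant for spanning, which this form of the Jacobi identity
    exploits. *)
Lemma brk_jacobi_scale i j r x y z :
  part i x = x -> part j y = y -> part r z = z ->
  exists a a' : K, brk (brk x y) z = a *: brk (brk y z) x + a' *: brk (brk x z) y.
Proof.
move=> ix jy rz.
have [a ea] := brk_skew_scale ix (brk_part _ _ _ _ jy rz).
have [a' ea'] := brk_skew_scale jy (brk_part _ _ _ _ ix rz).
exists a, (- ((-1) ^+ (i && j) * a')).
have := brk_jacobi _ _ _ _ z ix jy; rewrite ea ea' scalerA => ->.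
by rewrite scaleNr addrK.
Qed.

Lemma brk_odd_cube x : part true x = x -> brk (brk x x) x = 0.
Proof.
move=> x1; have xx0 : part false (brk x x) = brk x x.
  by rewrite -(brk_part _ _ _ _ x1 x1) /= part_id.
by apply: oppr_inj; rewrite -brk_skew_even // brk_odd // oppr0.
Qed.
End HomogeneousTriples.

Section Cover.
Variables (K : fieldType) (L : lieSuperalgType K) (P : freePresentation L).
Local Notation F := (fp_alg P).
Local Notation pi := (@fp_map _ _ P).
Local Notation R := (gker (fp_hom P)).
Local Notation D := (mult2_den P).

Lemma homogeneous_lift p (x : L) : part p x = x -> exists f : F, part p f = f /\ pi f = x.
Proof.
move=> px; have [f fx] := fp_surj P x; exists (part p f).
by rewrite part_id (hom_part (fp_hom P)) fx px.
Qed.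

Variable z : L.
Hypothesis z_central : forall x, brk z x = 0.
Hypothesis L_derived : forall x y : L, exists a, brk x y = a *: z.

Variables (p : bool) (a1 a2 : F).
Hypothesis a1_deg : part p a1 = a1.
Hypothesis a2_deg : part p a2 = a2.
Local Notation c := (brk a1 a2).
Hypothesis pi_c : pi c = z.

Let c_even : part false c = c.
Proof. by rewrite -(addbb p) (brk_part _ _ _ _ a1_deg a2_deg). Qed.

Lemma lcs3_ker f : lcs F 3 f -> R f.
Proof.
apply: gbrkP => x g [n [a [b [_ _ ->]]]] _; rewrite brk_suml.
apply: gset_fsum => i _ /=; rewrite !(homE (fp_hom P)).
by have [s ->] := L_derived (pi (a i)) (pi (b i)); rewrite brkZl z_central scaler0.
Qed.

(** [[f, g]] is a multiple of [c] up to an element of [R], and [[c, c] = 0]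
    because [c] is even; [[R, c]] lies in [D] because [c] is itself a
    bracket. *)
Lemma den_brk_c f g : D (brk (brk f g) c).
Proof.
have [a fg] := L_derived (pi f) (pi g).
have Rr : R (brk f g - a *: c).
  by rewrite /= (homB (fp_hom P)) (homZ (fp_hom P)) pi_c (homE (fp_hom P)) fg subrr.
rewrite -(subrK (a *: c) (brk f g)) brkDl brkZl brk_even // scaler0 addr0.
exact: den_r_ff.
Qed.

Section Span.
Variables (m l : nat) (b : 'I_(m + l) -> L) (X : 'I_(m + l) -> L -> K) (gam : L -> K).
Hypothesis coordE : forall x, x = \sum_i X i x *: b i + gam x *: z.
Variable v : 'I_(m + l) -> F.
Hypothesis v_deg : forall i : 'I_(m + l), part (odd_index m i) (v i) = v i.
Hypothesis pi_v : forall i, pi (v i) = b i.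

Definition hall_brk (t : 'I_(m + l) * 'I_(m + l) * 'I_(m + l)) : F :=
  brk (brk (v t.1.1) (v t.1.2)) (v t.2).

Variable T : F -> Prop.
Hypothesis T_linear : forall a x y, T x -> T y -> T (a *: x + y).
Hypothesis T_den : forall x, D x -> T x.
Hypothesis T_cfg : forall f g, T (brk (brk c f) g).

Definition hall_span (x : F) : Prop :=
  exists d : {t | hall t} -> K, T (x - \sum_t d t *: hall_brk (val t)).

Let T0 : T 0. Proof. by apply/T_den/gset0. Qed.

Lemma hall_spanT x : T x -> hall_span x.
Proof.
by move=> Tx; exists (fun=> 0); rewrite big1 ?subr0 // => t _; rewrite scale0r.
Qed.

Lemma hall_span_linear a x y : hall_span x -> hall_span y -> hall_span (a *: x + y).
Proof.
move=> [d dx] [e ey]; exists (fun t => a * d t + e t).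
have -> : a *: x + y - \sum_t (a * d t + e t) *: hall_brk (val t) =
    a *: (x - \sum_t d t *: hall_brk (val t)) + (y - \sum_t e t *: hall_brk (val t)).
  rewrite scalerBr addrACA -opprD scaler_sumr -big_split /=; congr (_ - _).
  by apply: eq_bigr => t _; rewrite scalerDl scalerA.
exact: T_linear.
Qed.

Lemma hall_spanD x y : hall_span x -> hall_span y -> hall_span (x + y).
Proof. by rewrite -[x in x + y]scale1r; apply: hall_span_linear. Qed.

Lemma hall_spanZ a x : hall_span x -> hall_span (a *: x).
Proof. by move=> hx; rewrite -[_ *: _]addr0; apply: hall_span_linear (hall_spanT T0). Qed.

Lemma hall_span_sum (I : finType) (f : I -> F) :
  (forall i, hall_span (f i)) -> hall_span (\sum_i f i).
Proof.
by move=> hf; elim/big_ind: _ => //; [apply: hall_spanT | exact: hall_spanD].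
Qed.

(** If [k < j < i], both terms given by the Jacobi identity satisfy the Hall
    condition. *)
Lemma hall_span_lt (i j k : 'I_(m + l)) : (j < i)%N -> hall_span (brk (brk (v i) (v j)) (v k)).
Proof.
have base (i' j' k' : 'I_(m + l)) : (j' < i')%N -> (j' <= k')%N ->
    hall_span (brk (brk (v i') (v j')) (v k')).
  move=> ji jk; have ht : hall (i', j', k') by rewrite /hall /= ji.
  exists (fun t => (t == Sub (i', j', k') ht)%:R).
  rewrite (bigD1 (Sub (i', j', k') ht)) //= eqxx scale1r big1 ?addr0.
    by rewrite subrr.
  by move=> t /negPf->; rewrite scale0r.
move=> ji; case: (leqP j k) => [|kj]; first exact: base.
have [s [s' ->]] := brk_jacobi_scale (v_deg i) (v_deg j) (v_deg k).
by apply: hall_spanD; apply: hall_spanZ; apply: base => //; lia.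
Qed.

Lemma hall_span_neq (i j k : 'I_(m + l)) : i != j -> hall_span (brk (brk (v i) (v j)) (v k)).
Proof.
rewrite -val_eqE neq_ltn => /orP[ij|]; last exact: hall_span_lt.
have [s ->] := brk_skew_scale (v_deg i) (v_deg j).
by rewrite brkZl; apply/hall_spanZ/hall_span_lt.
Qed.

(** The repeated index is the only point where parity matters: [[v_i, v_i]] is
    zero for even [v_i], but not for odd [v_i], and then
    [[[v_i, v_i], v_i] = 0] takes over. *)
Lemma hall_span_gens i j k : hall_span (brk (brk (v i) (v j)) (v k)).
Proof.
case: (eqVneq i j) => [<-|]; last exact: hall_span_neq.
case: (eqVneq i k) => [<-|ik].
  have := v_deg i; case: (odd_index _ _) => vi.
    by rewrite brk_odd_cube //; apply: hall_spanT.
  by rewrite brk_even // brk0l; apply: hall_spanT.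
have [s [s' ->]] := brk_jacobi_scale (v_deg i) (v_deg i) (v_deg k).
by apply: hall_spanD; apply: hall_spanZ; apply: hall_span_neq.
Qed.

Let w (t : 'I_(m + l) + 'I_1) : F := match t with inl i => v i | inr _ => c end.

Lemma lift_decomposition f : exists (d : 'I_(m + l) + 'I_1 -> K) r,
  R r /\ f = \sum_t d t *: w t + r.
Proof.
exists (fun t => match t with inl i => X i (pi f) | inr _ => gam (pi f) end).
set s := \sum_t _; exists (f - s); split; last by rewrite addrC subrK.
rewrite /= (homB (fp_hom P)) /s (hom_sum (fp_hom P)) big_sumType big_ord1 /=.
rewrite (homZ (fp_hom P)) pi_c [in X in X - _](coordE (pi f)).
under eq_bigr do rewrite (homZ (fp_hom P)) pi_v.
by rewrite subrr.
Qed.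

Lemma hall_span_gens_c t1 t2 t3 : hall_span (brk (brk (w t1) (w t2)) (w t3)).
Proof.
case: t1 => [i|u]; last by apply/hall_spanT/T_cfg.
case: t2 => [j|u] /=; last first.
  rewrite (brk_skew_even (v i) c_even) brkNl -scaleN1r.
  by apply/hall_spanZ/hall_spanT/T_cfg.
case: t3 => [k|u] /=; first exact: hall_span_gens.
by apply/hall_spanT/T_den/den_brk_c.
Qed.

Lemma hall_span_triple f g h : hall_span (brk (brk f g) h).
Proof.
have [df [rf [Rf ->]]] := lift_decomposition f.
have [dg [rg [Rg ->]]] := lift_decomposition g.
have [dh [rh [Rh ->]]] := lift_decomposition h.
set sf := \sum_t _; set sg := \sum_t _; set sh := \sum_t _.
have HD x : D x -> hall_span x by move=> /T_den/hall_spanT.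
rewrite brkDr; apply: hall_spanD; last by apply/HD/den_ffr.
rewrite (brkDl sf) brkDl; apply: hall_spanD; last by apply/HD/den_rff.
rewrite (brkDr _ sg) brkDl; apply: hall_spanD; last by apply/HD/den_frf.
rewrite /sf brk_suml brk_suml; apply: hall_span_sum => t1.
rewrite /sg (brk_sumr (_ *: w t1)) brk_suml; apply: hall_span_sum => t2.
rewrite /sh brk_sumr; apply: hall_span_sum => t3.
rewrite !(brkZl, brkZr); do 3!apply: hall_spanZ.
exact: hall_span_gens_c.
Qed.

(** [T] stands for the span of the degree four part modulo [D].  Keeping it
    abstract lets the same argument serve for every rank of the form. *)
Lemma hall_span_lcs3 x : lcs F 3 x -> hall_span x.
Proof.
move=> [n [a [b' [ha _ ->]]]]; apply: hall_span_sum => i.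
have [n' [a' [b'' [_ _ ->]]]] := ha i.
rewrite brk_suml; apply: hall_span_sum => j; exact: hall_span_triple.
Qed.

End Span.
End Cover.

(** * Independence of the brackets of degree three *)

Section HallFree.
Variables (K : fieldType) (L : lieSuperalgType K) (P : freePresentation L).
Local Notation F := (fp_alg P).
Local Notation pi := (@fp_map _ _ P).
Local Notation R := (gker (fp_hom P)).
Local Notation D := (mult2_den P).
Variables (m l : nat) (b : 'I_(m + l) -> L) (X : 'I_(m + l) -> L -> K).
Hypothesis X_linear : forall i a x y, X i (a *: x + y) = a * X i x + X i y.
Hypothesis X_part : forall (i : 'I_(m + l)) p x,
  X i (part p x) = if p == odd_index m i then X i x else 0.
Hypothesis X_b : forall i j, X i (b j) = (j == i)%:R.
Hypothesis X_brk : forall i x y, X i (brk x y) = 0.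

Lemma lcs_band (N : nat) (g : 'I_N -> bool) (phi : F -> glmx K g) n f :
  is_lie_hom phi -> (forall f, band 1 (phi f)) -> lcs F n.+1 f -> band n.+1 (phi f).
Proof.
move=> phiH b1; elim: n f => [|n IH] f; first by move=> _; apply: b1.
apply: (gbrkP (D := gpreim phiH (gband g n.+2))) => x y /IH bx _.
by rewrite /= (homE phiH) -addn1; apply: band_brk.
Qed.

(** The coefficient of the word [w_0 w_1 w_2] in a bracket of three elements,
    the linear parts of which are given by their images in [L].  As the forms
    [X i] vanish on [L^2], the superdiagonal map preserves brackets modulo
    [band 2], so the image of [D] is in [band 4], which is zero for matrices
    of size four. *)
Lemma word_coefficient (w : nat -> 'I_(m + l)) :
  let e t f := X (w t) (pi f) in
  exists theta : F -> K,
  [/\ forall a x y, theta (a *: x + y) = a * theta x + theta y,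
      forall x, D x -> theta x = 0, forall x, lcs F 4 x -> theta x = 0 &
      forall p q r x y u, part p x = x -> part q y = y -> part r u = u ->
        theta (brk (brk x y) u) =
        (e 0%N x * e 1%N y - (-1) ^+ (p && q) * (e 0%N y * e 1%N x)) * e 2%N u
        - (-1) ^+ ((p (+) q) && r) *
          (e 0%N u * (e 1%N x * e 2%N y - (-1) ^+ (p && q) * (e 1%N y * e 2%N x)))].
Proof.
move=> e; pose chi t := X (w t); pose par (t : nat) := odd_index m (w t).
have chi_linear t a x y : chi t (a *: x + y) = a * chi t x + chi t y by apply: X_linear.
have chi_part t p x : chi t (part p x) = if p == par t then chi t x else 0.
  exact: X_part.
pose psi := @superdiag K L 4 chi par.
have psi_linear : linear psi by apply: superdiag_linear.
have psi_brk x y : band 2 (psi (brk x y) - brk (psi x) (psi y)).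
  have -> : psi (brk x y) = 0.
    by apply/matrixP=> i j; rewrite !mxE /chi X_brk if_same.
  rewrite sub0r; apply: (@gsetN _ _ (gband _ 2)).
  by apply: (@band_brk _ _ _ 1 1); apply: superdiag_band.
have psi_part := @superdiag_part K L 4 chi par chi_part.
have psi_band : forall x, band 1 (psi x) by apply: superdiag_band.
have [phi [phiH phi_psi]] :=
  @lift_mod_band _ _ P _ _ psi 2 isT psi_linear psi_part psi_band psi_brk.
have [phi1 phiD] := @lift_den _ _ P _ _ psi 2 isT psi_linear psi_band phi phiH phi_psi.
have phi_e f (i j : 'I_4) : j = i.+1 :> nat -> phi f i j = e i f.
  move=> ij; have := phi_psi f i j; rewrite ij addn2 ltnSn => /(_ isT)/eqP.
  by rewrite !mxE ij eqxx subr_eq0 => /eqP.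
pose i0 : 'I_4 := @Ordinal 4 0 isT; pose i1 : 'I_4 := @Ordinal 4 1 isT.
pose i2 : 'I_4 := @Ordinal 4 2 isT; pose i3 : 'I_4 := @Ordinal 4 3 isT.
exists (fun f => phi f i0 i3); split.
- by move=> a x y; case: phiH => -> _ _; rewrite !mxE.
- by move=> x /phiD bx; rewrite bx.
- by move=> x /(lcs_band phiH phi1) bx; rewrite bx.
move=> p q r x y u px qy ru.
have hpart s f : part s f = f -> part s (phi f) = phi f.
  by move=> sf; rewrite -(hom_part phiH) sf.
rewrite !(homE phiH) (band_brk_entry (s := 2) (t := 1) (p := p (+) q) (q := r)
  (k := i2) (k' := i1)) //; first last.
- exact: hpart.
- by apply: brk_part; apply: hpart.
- exact: (band_brk (s := 1) (t := 1)).
rewrite (band_brk_entry (s := 1) (t := 1) (p := p) (q := q)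
  (k := i1) (k' := i1)) //; try exact: hpart.
rewrite (band_brk_entry (s := 1) (t := 1) (p := p) (q := q)
  (k := i2) (k' := i2)) //; try exact: hpart.
by rewrite !phi_e.
Qed.

Variable v : 'I_(m + l) -> F.
Hypothesis v_deg : forall i : 'I_(m + l), part (odd_index m i) (v i) = v i.
Hypothesis pi_v : forall i, pi (v i) = b i.

(** A word that occurs in [[[v_i, v_j], v_k]] and in no other bracket satisfying
    the Hall condition.  Starting with the least letter leaves two candidates;
    for [k = j] the word [jij] has coefficient [0] or [2], up to sign. *)
Definition hall_word (t : 'I_(m + l) * 'I_(m + l) * 'I_(m + l)) (n : nat) : 'I_(m + l) :=
  let: (i, j, k) := t in
  nth j (if k == j then [:: j; j; i] else [:: j; i; k]) n.

Lemma hall_word_off i j k i' j' k' (w := hall_word (i, j, k)) :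
  hall (i, j, k) -> hall (i', j', k') -> (i', j', k') != (i, j, k) ->
  [/\ (i' == w 0%N) && (j' == w 1%N) && (k' == w 2%N) = false,
      (j' == w 0%N) && (i' == w 1%N) && (k' == w 2%N) = false,
      (k' == w 0%N) && ((i' == w 1%N) && (j' == w 2%N)) = false &
      (k' == w 0%N) && ((j' == w 1%N) && (i' == w 2%N)) = false].
Proof.
rewrite /w /hall /= => /andP[ji jk] /andP[ji' jk'] ne.
case: (eqVneq k j) ne => [->|kj] ne /=; split; apply/negP.
all: try by case/andP=> /andP[/eqP e1 /eqP e2] /eqP e3; subst; lia.
all: try by case/andP=> /eqP e1 /andP[/eqP e2 /eqP e3]; subst; lia.
- by case/andP=> /eqP e1 /andP[/eqP e2 /eqP e3]; case/eqP: ne; rewrite e1 e2 e3.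
- by case/andP=> /andP[/eqP e1 /eqP e2] /eqP e3; case/eqP: ne; rewrite e1 e2 e3.
- case/andP=> /eqP e1 /andP[/eqP e2 /eqP e3].
  by case/eqP: kj; apply: val_inj => /=; subst; lia.
Qed.

Lemma hall_free (d : {t : 'I_(m + l) * 'I_(m + l) * 'I_(m + l) | hall t} -> K) y :
  lcs F 4 y -> D (\sum_t d t *: hall_brk v (val t) + y) -> forall t, d t = 0.
Proof.
move=> y4 Dy t0; have [theta [th_lin thD th4 thE]] := word_coefficient (hall_word (val t0)).
have th0 : theta 0 = 0 by apply/thD/gset0.
have thS : theta (\sum_t d t *: hall_brk v (val t)) = \sum_t d t * theta (hall_brk v (val t)).
  elim/big_ind2: _ => // [s s' u u' <- <-|t _].
    by have := th_lin 1 s' u'; rewrite scale1r mul1r.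
  by rewrite -[_ *: _]addr0 th_lin th0 addr0.
have := thD _ Dy; rewrite -[\sum_t _]scale1r th_lin mul1r (th4 y y4) addr0 thS.
(* The coordinates of [v i] are Kronecker symbols: [theta] compares words. *)
have th_hall (t : {t : 'I_(m + l) * 'I_(m + l) * 'I_(m + l) | hall t}) :
  theta (hall_brk v (val t)) =
  let: (i, j, k) := val t in let w := hall_word (val t0) in
  let s := (-1) ^+ (odd_index m i && odd_index m j) in
  let s' := (-1) ^+ ((odd_index m i (+) odd_index m j) && odd_index m k) in
  ((i == w 0%N)%:R * (j == w 1%N)%:R - s * ((j == w 0%N)%:R * (i == w 1%N)%:R)) * (k == w 2%N)%:R
  - s' * ((k == w 0%N)%:R * ((i == w 1%N)%:R * (j == w 2%N)%:R
       - s * ((j == w 1%N)%:R * (i == w 2%N)%:R))) :> K.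
  by case: t => [[[i j] k] ht]; rewrite /hall_brk /=
    (thE _ _ _ _ _ _ (v_deg i) (v_deg j) (v_deg k)) !pi_v !X_b.
rewrite (bigD1 t0) //= big1 ?addr0 => [|t tt0].
  move/eqP; rewrite mulf_eq0.
  suff /negPf-> : theta (hall_brk v (val t0)) != 0 by rewrite orbF => /eqP.
  rewrite th_hall.
  case: (t0) => [[[i j] k] /= h0]; have /andP[/= ji jk] := h0.
  have nij : (i == j) = false by apply/negbTE; rewrite -val_eqE /=; lia.
  have nji : (j == i) = false by rewrite eq_sym.
  case: (eqVneq k j) => [->|kj] /=.
    rewrite !eqxx nij nji !(mul0r, mulr0, mulr1, subr0, sub0r, mul1r) mulrN opprK -signr_addb.
    by rewrite signr_eq0.
  have nkj := negbTE kj; have njk : (j == k) = false by rewrite eq_sym.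
  rewrite !eqxx nij nji nkj !(mul0r, mulr0, mulr1, subr0, sub0r, mul1r) oppr_eq0.
  by rewrite signr_eq0.
rewrite th_hall; move: tt0; rewrite -val_eqE.
case: t0 t {Dy thS th_hall thE} => [[[i j] k] /= h0] [[[i' j'] k'] /= h1] tt0.
have := hall_word_off h0 h1 tt0; rewrite /= => -[e1 e2 e3 e4].
have z3 x1 x2 x3 : x1 && x2 && x3 = false -> x1%:R * x2%:R * x3%:R = 0 :> K.
  by rewrite -!natrM !mulnb => ->.
have z3' x1 x2 x3 : x1 && (x2 && x3) = false -> x1%:R * (x2%:R * x3%:R) = 0 :> K.
  by rewrite andbA mulrA; apply: z3.
rewrite [X in _ * X](_ : _ = 0) ?mulr0 //.
rewrite mulrBl (z3 _ _ _ e1) -mulrA (z3 _ _ _ e2) mulr0 subr0.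
by rewrite (mulrBr _%:R) (z3' _ _ _ e3) (mulrCA _%:R) (z3' _ _ _ e4) !(mulr0, subr0).
Qed.

End HallFree.

(** * The degree four part *)

Section HeisenbergRep.
Variables (K : fieldType) (L : lieSuperalgType K) (P : freePresentation L).
Local Notation F := (fp_alg P).
Local Notation pi := (@fp_map _ _ P).
Local Notation D := (mult2_den P).
Variables (al be gam : L -> K) (p : bool) (u1 u2 : L).
Hypothesis al_linear : forall a x y, al (a *: x + y) = a * al x + al y.
Hypothesis be_linear : forall a x y, be (a *: x + y) = a * be x + be y.
Hypothesis gam_linear : forall a x y, gam (a *: x + y) = a * gam x + gam y.
Hypothesis al_part : forall q x, al (part q x) = if q == p then al x else 0.
Hypothesis be_part : forall q x, be (part q x) = if q == p then be x else 0.
Hypothesis gam_part : forall q x, gam (part q x) = if q then 0 else gam x.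
Hypothesis al_brk : forall x y, al (brk x y) = 0.
Hypothesis be_brk : forall x y, be (brk x y) = 0.
Hypothesis gam_brk : forall x y, gam (brk x y) = al x * be y - be x * al y.
Hypothesis u1_deg : part p u1 = u1.
Hypothesis u2_deg : part p u2 = u2.
Hypothesis u1_coord : al u1 = 1 /\ be u1 = 0.
Hypothesis u2_coord : al u2 = 0 /\ be u2 = 1.
Hypothesis odd_char2 : p -> 2%:R = 0 :> K.

(** In the odd case the supercommutator of [Y] with itself is [2 Y^2], which
    vanishes in characteristic two. *)
Lemma gl_square_zero N (g : 'I_N -> bool) (Y : glmx K g) : part p Y = Y -> brk Y Y = 0.
Proof.
case: p odd_char2 => [/(_ isT) two0|_] Yp; last exact: brk_even.
have -> : brk Y Y = Y *m Y - (-1) ^+ (true && true) *: (Y *m Y) := gl_brkE Yp Yp.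
by rewrite expr1 scaleN1r opprK -mulr2n -scaler_nat two0 scale0r.
Qed.

(** The analogue in degree four, for words in two letters of the same parity.
    As the image of [z] must be the bracket of those of [u1] and [u2], a
    correction on the second diagonal is added to the superdiagonal map.  All
    signs are [1], since the letters are even or [2 = 0]. *)
Lemma word4_coefficient (w : nat -> bool) :
  let e t f := if w t then be (pi f) else al (pi f) in
  exists theta : F -> K,
  [/\ forall a x y, theta (a *: x + y) = a * theta x + theta y,
      forall x, D x -> theta x = 0 &
      forall a b x y, part p a = a -> part p b = b -> part p x = x -> part p y = y ->
        let c t := e t a * e t.+1 b - e t b * e t.+1 a in
        theta (brk (brk (brk a b) x) y) =
        (c 0%N * e 2%N x - e 0%N x * c 1%N) * e 3%N y
        - e 0%N y * (c 1%N * e 3%N x - e 1%N x * c 2%N)].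
Proof.
move=> e; pose chi t x := if w t then be x else al x.
have chi_linear t a x y : chi t (a *: x + y) = a * chi t x + chi t y.
  by rewrite /chi; case: (w t).
have chi_part t q x : chi t (part q x) = if q == p then chi t x else 0.
  by rewrite /chi; case: (w t).
pose S := @superdiag K L 5 chi (fun=> p).
have S_linear : linear S := @superdiag_linear K L 5 chi (fun=> p) chi_linear.
have S_part q x : S (part q x) = part q (S x) :=
  @superdiag_part K L 5 chi (fun=> p) chi_part q x.
have S_band : forall x, band 1 (S x) by apply: superdiag_band.
have S_deg u : part p u = u -> part p (S u) = S u by move=> pu; rewrite -S_part pu.

have SE x : S x = al x *: S u1 + be x *: S u2.
  apply/matrixP=> i j; rewrite !mxE /chi; case: eqP => _; last by rewrite !mulr0 addr0.
  case: u1_coord u2_coord => -> -> [-> ->].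
  by case: (w i); rewrite !mulr0 ?mulr1 ?addr0 ?add0r.
have [C CE] : exists C, C = brk (S u1) (S u2) by exists (brk (S u1) (S u2)).
have C_band : band 2 C by rewrite CE; apply: (@band_brk _ _ _ 1 1).
have C_even : part false C = C by rewrite CE -(addbb p) brk_part // S_deg.
have SS0 (Y : glmx K (prefix_parity (fun=> p))) : part p Y = Y -> brk Y Y = 0.
  by apply: gl_square_zero.
have S21 : brk (S u2) (S u1) = - C.
  have : brk (S u1 + S u2) (S u1 + S u2) = 0 by rewrite SS0 // linearD /= !S_deg.
  rewrite brkDl !brkDr !SS0 ?S_deg // addr0 add0r => /eqP.
  by rewrite addrC addr_eq0 -CE => /eqP.
pose psi x := S x + gam x *: C.
have psi_linear : linear psi.
  by move=> a x y; rewrite /psi S_linear gam_linear scalerDl scalerDr scalerA addrACA.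
have psi_part q x : psi (part q x) = part q (psi x).
  rewrite /psi linearD linearZ /= gam_part S_part -[in RHS]C_even part_part.
  by case: q; rewrite ?C_even ?scale0r ?scaler0.
have psi_band x : band 1 (psi x).
  apply: (@gsetD _ _ (gband _ 1)); [exact: S_band|apply: (@gsetZ _ _ (gband _ 1))].
  exact: bandW C_band.
have psi_brk x y : band 3 (psi (brk x y) - brk (psi x) (psi y)).
  have -> : psi (brk x y) = brk (S x) (S y).
    have S0 : S (brk x y) = 0 by rewrite SE al_brk be_brk !scale0r addr0.
    rewrite /psi S0 add0r gam_brk (SE x) (SE y) !(brkDl, brkDr, brkZl, brkZr).
    by rewrite !SS0 ?S_deg // S21 !scaler0 addr0 add0r -CE scalerBl !scalerN !scalerA.
  rewrite /psi; have -> A A' B B' : brk (A + B) (A' + B') =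
      brk A A' + (brk A B' + (brk B A' + brk B B')) :> glmx K (prefix_parity (fun=> p)).
    by rewrite brkDl !brkDr -addrA.
  rewrite opprD addrA subrr sub0r !brkZl !brkZr.
  have bD := @gsetD _ _ (gband (prefix_parity (fun=> p)) 3).
  have bZ := @gsetZ _ _ (gband (prefix_parity (fun=> p)) 3).
  apply: (@gsetN _ _ (gband _ 3)); apply: (bD); [apply: (bZ)|apply: (bD); apply: (bZ)].
  - exact: (band_brk (S_band x) C_band).
  - exact: (band_brk C_band (S_band y)).
  - by apply: (bZ); apply: bandW (band_brk C_band C_band).
have [phi [phiH phi_psi]] :=
  @lift_mod_band _ _ P _ _ psi 3 isT psi_linear psi_part psi_band psi_brk.
have [phi1 phiD] := @lift_den _ _ P _ _ psi 3 isT psi_linear psi_band phi phiH phi_psi.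
have phi_e f (i j : 'I_5) : j = i.+1 :> nat -> phi f i j = e i f.
  move=> ij; have := phi_psi f i j; rewrite ij addn3 ltnS leqnSn => /(_ isT)/eqP.
  have -> : (phi f - psi (pi f)) i j = phi f i j - (S (pi f) i j + gam (pi f) * C i j).
    by rewrite 2![in LHS]mxE /psi [in LHS]mxE [X in _ - (_ + X)]mxE.
  rewrite C_band; last by rewrite ij addn2.
  by rewrite mulr0 addr0 (@superdiagE _ _ _ _ _ _ _ _ ij) subr_eq0 => /eqP.
pose o n (h : (n < 5)%N) : 'I_5 := Ordinal h.
exists (fun f => phi f (o 0%N isT) (o 4%N isT)); split.
- by move=> a x y; case: phiH => -> _ _; rewrite !mxE.
- by move=> x /phiD bx; rewrite bx.
move=> a b x y pa pb px py c.
have hpart f : part p f = f -> part p (phi f) = phi f.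
  by move=> pf; rewrite -(hom_part phiH) pf.
have sign1 : (-1) ^+ (p && p) = 1 :> K.
  case: (p) odd_char2 => // /(_ isT) two0; rewrite expr1.
  by apply/eqP; rewrite eq_sym -subr_eq0 opprK -mulr2n two0.
have ab_even : part false (brk a b) = brk a b by rewrite -(addbb p) brk_part.
have abx_deg : part p (brk (brk a b) x) = brk (brk a b) x.
  by have := brk_part _ _ _ _ ab_even px; rewrite addFb.
have ab_phi : part false (phi (brk a b)) = phi (brk a b) by rewrite -(hom_part phiH) ab_even.
have abx_phi : part p (phi (brk (brk a b) x)) = phi (brk (brk a b) x).
  exact: hpart.
have b2 : band 2 (phi (brk a b)) by rewrite (homE phiH); apply: (@band_brk _ _ _ 1 1).
have b3 : band 3 (phi (brk (brk a b) x)).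
  by rewrite (homE phiH); apply: (@band_brk _ _ _ 2 1).
have cE (i j k : 'I_5) : k = i.+1 :> nat -> j = i.+2 :> nat ->
    phi (brk a b) i j = c i.
  move=> ki ji; rewrite (homE phiH) (band_brk_entry (phi1 a) (phi1 b) (hpart _ pa) (hpart _ pb)
    (k := k) (k' := k)) ?addn1 ?ki //.
  by rewrite sign1 mul1r !phi_e ?ki.
have cxE (i k1 k2 j : 'I_5) : k1 = i.+1 :> nat -> k2 = i.+2 :> nat -> j = i.+3 :> nat ->
    phi (brk (brk a b) x) i j = c i * e i.+2 x - e i x * c i.+1.
  move=> k1i k2i ji; rewrite [phi _](homE phiH) (band_brk_entry b2 (phi1 x) ab_phi (hpart _ px)
    (k := k2) (k' := k1)) ?addn1 ?addn2 ?k2i //.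
  rewrite expr0 mul1r (@cE _ _ k1) // (@cE k1 j k2) ?k1i ?k2i //.
  by rewrite !phi_e ?k2i ?k1i.
rewrite (homE phiH) (band_brk_entry b3 (phi1 y) abx_phi (hpart _ py)
    (k := o 3%N isT) (k' := o 1%N isT)) //.
rewrite sign1 mul1r (@cxE _ (o 1%N isT) (o 2%N isT)) // (@cxE (o 1%N isT) (o 2%N isT) (o 3%N isT)) //.
by rewrite !phi_e.
Qed.

End HeisenbergRep.

Section Quartic.
Variables (K : fieldType) (L : lieSuperalgType K) (P : freePresentation L).
Local Notation F := (fp_alg P).
Local Notation pi := (@fp_map _ _ P).
Local Notation R := (gker (fp_hom P)).
Local Notation E := (gbrk R gfull).
Local Notation D := (mult2_den P).

Let piE := homE (fp_hom P).
Let piB := homB (fp_hom P).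
Let piZ := homZ (fp_hom P).

(** [d] is a basis of the degree four part modulo [D]. *)
Definition quartic_basis (c : F) e (d : 'I_e -> F) : Prop :=
  [/\ forall i, lcs F 4 (d i), forall i, part false (d i) = d i,
      forall f g, exists s : 'I_e -> K, D (brk (brk c f) g - \sum_i s i *: d i) &
      forall s : 'I_e -> K, D (\sum_i s i *: d i) -> forall i, s i = 0].

Lemma quartic_basis0 c (d : 'I_0 -> F) : (forall f, E (brk c f)) -> quartic_basis c d.
Proof.
move=> cE; split=> [[]//|[]//|f g|s _ []//]; exists (fun=> 0).
by rewrite big_ord0 subr0; apply: gbrk_mem.
Qed.

(** By the Jacobi identity, an element that commutes in [L] with the factors of
    a bracket commutes with that bracket modulo [[R, F]]. *)
Lemma ker_brk_brk i j a b f : part i a = a -> part j b = b ->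
  R (brk a f) -> R (brk b f) -> E (brk (brk a b) f).
Proof.
move=> ia jb Raf Rbf; have := brk_jacobi _ _ _ _ f ia jb.
move/esym/(canRL (addrK _)) => ->; apply: gsetB; first exact: gbrk_fullr.
by apply/gsetZ/gbrk_fullr.
Qed.

Variables (z : L) (gam : L -> K).
Hypothesis z_even : part false z = z.
Hypothesis z_neq0 : z != 0.
Hypothesis z_central : forall x, brk z x = 0.
Hypothesis L_derived : forall x y : L, exists a, brk x y = a *: z.
Hypothesis gam_linear : forall a x y, gam (a *: x + y) = a * gam x + gam y.
Hypothesis gam_part : forall q x, gam (part q x) = if q then 0 else gam x.
Hypothesis gam_z : gam z = 1.

Let gam0 : gam 0 = 0.
Proof. by have := gam_linear (-1) 0 0; rewrite scaler0 addr0 mulN1r addNr. Qed.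

Let gamZ a x : gam (a *: x) = a * gam x.
Proof. by rewrite -[_ *: _]addr0 gam_linear gam0 addr0. Qed.

Let gamD x y : gam (x + y) = gam x + gam y.
Proof. by rewrite -[x]scale1r gam_linear mul1r scale1r. Qed.

Lemma form_brk x y : brk x y = gam (brk x y) *: z.
Proof. by have [a ->] := L_derived x y; rewrite gamZ gam_z mulr1. Qed.

Lemma normalize_pair i j x y : part i x = x -> part j y = y -> brk x y != 0 ->
  i = j /\ exists a, brk (a *: x) y = z.
Proof.
move=> ix jy xy0; have g0 : gam (brk x y) != 0.
  by apply: contraNneq xy0 => g0; rewrite form_brk g0 scale0r.
split; last by exists (gam (brk x y))^-1; rewrite brkZl [X in _ *: X]form_brk scalerK.
have := gam_part (i (+) j) (brk x y); rewrite (brk_part _ _ _ _ ix jy).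
by case: i j {ix jy} => [] [] //= /eqP; rewrite (negPf g0).
Qed.

Lemma homogeneous_pair (x y : L) : brk x y != 0 -> exists i j, brk (part i x) (part j y) != 0.
Proof.
move=> xy; apply: contrapT => h; case/eqP: xy; rewrite brk_parts.
apply: big1 => i _; apply: big1 => j _; apply: contrapT => /eqP ij.
by apply: h; exists i, j.
Qed.

(** For a lift [b] of [y], the bracket [[b, f]] is a multiple of [[b, b]]
    modulo [R], and [[b, [b, b]] = 0]; since [[[b, b], f] = 2 [b, [b, f]]],
    the bracket of [[b, b]] with [f] lies in [[R, F]]. *)
Lemma quartic_odd_square (y : L) : part true y = y -> brk y y != 0 ->
  exists (a1 a2 : F), [/\ part true a1 = a1, part true a2 = a2, pi (brk a1 a2) = z &
    forall f, E (brk (brk a1 a2) f)].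
Proof.
move=> y1 yy0; have [_ [a yz]] := normalize_pair y1 y1 yy0.
have [b [b1 by_]] := homogeneous_lift P y1.
exists (a *: b), b; split=> // [||f]; first by rewrite linearZ /= b1.
  by rewrite piE piZ by_.
have Rr : R (brk b f - gam (brk y (pi f)) *: (a *: brk b b)).
  by rewrite /= piB piE !piZ piE by_ -brkZl yz [X in X - _]form_brk subrr.
set s := gam _ in Rr; rewrite !brkZl; apply: gsetZ.
have -> : brk (brk b b) f = 2%:R *: brk b (brk b f).
  have := brk_jacobi _ _ _ _ f b1 b1; rewrite expr1 scaleN1r => /esym/(canRL (addrK _)).
  by rewrite opprK scaler_nat mulr2n => ->.
apply: gsetZ; rewrite -(subrK (s *: (a *: brk b b)) (brk b f)) brkDr !brkZr.
by rewrite brk_odd // !scaler0 addr0; apply: gbrk_fullr.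
Qed.

Section Pair.
Hypothesis square0 : forall q (x : L), part q x = x -> brk x x = 0.
Variables (p : bool) (a1 a2 : F).
Hypothesis a1_deg : part p a1 = a1.
Hypothesis a2_deg : part p a2 = a2.
Local Notation c := (brk a1 a2).
Hypothesis pi_c : pi c = z.
Local Notation u1 := (pi a1).
Local Notation u2 := (pi a2).

Let u1_deg : part p u1 = u1. Proof. by rewrite -(hom_part (fp_hom P)) a1_deg. Qed.
Let u2_deg : part p u2 = u2. Proof. by rewrite -(hom_part (fp_hom P)) a2_deg. Qed.
Let u12 : brk u1 u2 = z. Proof. by rewrite -piE. Qed.
(** As squares vanish, the form is alternating, whatever the parities. *)
Let u21 : brk u2 u1 = - z.
Proof.
have : brk (u1 + u2) (u1 + u2) = 0 by apply: (@square0 p); rewrite linearD /= u1_deg u2_deg.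
rewrite brkDl !brkDr !(square0 u1_deg, square0 u2_deg) addr0 add0r u12 => /eqP.
by rewrite addrC addr_eq0 => /eqP.
Qed.

(** The orthogonal of the plane spanned by [u1] and [u2]; it contains [z]. *)
Definition perp (x : L) : Prop := brk u1 x = 0 /\ brk u2 x = 0.

(** The coordinates of [x] along [u1] and [u2] in the decomposition of [L] into
    that plane and its orthogonal. *)
Definition alpha x := - gam (brk u2 x).
Definition beta x := gam (brk u1 x).

Lemma perp_decomposition x : perp (x - alpha x *: u1 - beta x *: u2).
Proof.
rewrite /perp !brkDr !brkNr !brkZr !(square0 u1_deg, square0 u2_deg) u12 u21.
rewrite !scaler0 !subr0 /alpha /beta; split.
  by rewrite -form_brk subrr.
by rewrite scalerN scaleNr opprK -form_brk subrr.
Qed.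

Lemma perp_part q x : perp x -> perp (part q x).
Proof.
have h u : part p u = u -> brk u x = 0 -> brk u (part q x) = 0.
  move=> pu ux; have hr r := brk_part _ _ _ _ pu (part_id r x).
  have xq : x = part q x + part (~~ q) x.
    by case: (q); rewrite /= -[LHS]part_sum // addrC.
  have := congr1 (part (p (+) q)) ux; rewrite [X in brk u X]xq brkDr linearD linear0 /=.
  by rewrite hr -(hr (~~ q)) part_part addbN; case: (p (+) q); rewrite /= addr0.
by case=> *; split; apply: h.
Qed.

Lemma perp_swap x : perp x -> brk x u1 = 0 /\ brk x u2 = 0.
Proof.
have h u : part p u = u -> (forall q, brk u (part q x) = 0) -> brk x u = 0.
  move=> pu ux; rewrite -(part_sum x) brkDl !(brk_skew _ _ _ _ (part_id _ x) pu).
  by rewrite !ux !scaler0 subr0 oppr0.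
by move=> px; split; apply: h => // q; case: (perp_part q px).
Qed.

Lemma perp_ker f : perp (pi f) -> E (brk c f).
Proof. by case=> h1 h2; apply: (ker_brk_brk a1_deg a2_deg); rewrite /= piE. Qed.

Lemma lift_decomposition_pair f : exists f', perp (pi f') /\
  f = f' + (beta (pi f) *: a2 + alpha (pi f) *: a1).
Proof.
exists (f - alpha (pi f) *: a1 - beta (pi f) *: a2).
split; last by rewrite addrA !subrK.
by rewrite !piB !piZ; apply: perp_decomposition.
Qed.

(** An orthogonal pair [x], [y] with [[x, y]] proportional to [z] yields a second
    expression of [c] modulo [R], from lifts that commute with [a1] and [a2]
    modulo [R].  So [c] commutes with [a1] and [a2] modulo [[R, F]], while it
    commutes with the orthogonal in any case. *)
Lemma quartic_rank4 i j x y : part i x = x -> part j y = y -> perp x -> perp y ->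
  brk x y != 0 -> forall f, E (brk c f).
Proof.
move=> ix jy px py xy0 f; have [_ [s sxy]] := normalize_pair ix jy xy0.
have [b1 [b1_deg b1x]] := homogeneous_lift P ix.
have [b2 [b2_deg b2y]] := homogeneous_lift P jy.
have Rc : R (c - brk (s *: b1) b2) by rewrite /= piB pi_c !piE piZ b1x b2y sxy subrr.
have key a : brk x (pi a) = 0 -> brk y (pi a) = 0 -> E (brk c a).
  move=> xa ya; rewrite -(subrK (brk (s *: b1) b2) c) brkDl; apply: gsetD.
    exact: gbrk_mem.
  rewrite brkZl brkZl; apply: gsetZ; apply: (ker_brk_brk b1_deg b2_deg).
    by rewrite /= piE b1x.
  by rewrite /= piE b2y.
have [[xu1 xu2] [yu1 yu2]] := (perp_swap px, perp_swap py).
have E1 : E (brk c a1) by apply: key.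
have E2 : E (brk c a2) by apply: key.
have [f' [pf' ->]] := lift_decomposition_pair f.
rewrite !brkDr; apply: gsetD; first exact: perp_ker.
by rewrite !brkZr; apply: gsetD; apply: gsetZ.
Qed.

Section Rank2.
Hypothesis perp_abelian : forall x y, perp x -> perp y -> brk x y = 0.

Lemma form_rank2 x y : gam (brk x y) = alpha x * beta y - beta x * alpha y.
Proof.
have split_pair v : exists v', perp v' /\ v = v' + (beta v *: u2 + alpha v *: u1).
  exists (v - alpha v *: u1 - beta v *: u2); split; first exact: perp_decomposition.
  by rewrite addrA !subrK.
have [x' [px xE]] := split_pair x; have [y' [py yE]] := split_pair y.
rewrite [in LHS]xE [in LHS]yE !(brkDl, brkDr, brkZl, brkZr).
have [-> ->] := perp_swap px; have [-> ->] := py.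
rewrite (perp_abelian px py) (square0 u1_deg) (square0 u2_deg) u12 u21.
rewrite !scaler0 !(addr0, add0r) !scalerN !scalerA gamD gamZ -scaleNr gamZ gam_z.
by ring.
Qed.

Lemma brk_perp_ker f g : perp (pi g) -> R (brk f g).
Proof.
move=> pg; rewrite /= piE form_brk form_rank2.
by case: pg => h1 h2; rewrite /alpha /beta h1 h2 gam0 oppr0 !mulr0 subrr scale0r.
Qed.

Let i0 : 'I_3 := @Ordinal 3 0 isT.
Let i1 : 'I_3 := @Ordinal 3 1 isT.
Let i2 : 'I_3 := @Ordinal 3 2 isT.

Definition quartic_gens (i : 'I_3) : F :=
  match val i with
  | 0 => brk (brk c a1) a1
  | 1 => brk (brk c a1) a2
  | _ => brk (brk c a2) a2
  end.

Let c_even : part false c = c.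
Proof. by rewrite -(addbb p) (brk_part _ _ _ _ a1_deg a2_deg). Qed.

(** This is [[c, [a1, a2]] = [c, c] = 0], and the reason why there are three
    elements and not four. *)
Lemma quartic_swap : brk (brk c a2) a1 = (-1) ^+ p *: brk (brk c a1) a2.
Proof.
have := brk_jacobi _ _ _ _ a2 c_even a1_deg; rewrite /= expr0 scale1r.
rewrite brk_even //.
have ca2 := brk_part _ _ _ _ c_even a2_deg; rewrite addFb in ca2.
rewrite (brk_skew _ _ _ _ a1_deg ca2) andbb => /eqP; rewrite eq_sym subr_eq0 => /eqP ->.
by rewrite scalerA -signr_addb addbb scale1r.
Qed.

Lemma quartic_rank2_span f g :
  exists s : 'I_3 -> K, D (brk (brk c f) g - \sum_i s i *: quartic_gens i).
Proof.
have [f' [pf fE]] := lift_decomposition_pair f.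
have [g' [pg gE]] := lift_decomposition_pair g.
have Dg i a : part i a = a -> D (brk (brk c a) g').
  move=> ia; have := brk_jacobi _ _ _ _ g' c_even ia.
  rewrite andFb expr0 scale1r => /esym/(canRL (addrK _)) ->; apply: gsetB.
    by apply/den_ffr/brk_perp_ker.
  by apply/gbrkC/gbrk_mem => //; apply: perp_ker.
exists (fun i => match val i with
  | 0 => alpha (pi f) * alpha (pi g)
  | 1 => alpha (pi f) * beta (pi g) + (-1) ^+ p * (beta (pi f) * alpha (pi g))
  | _ => beta (pi f) * beta (pi g) end).
pose Y1 := beta (pi g) *: quartic_gens i1 + alpha (pi g) *: quartic_gens i0.
pose Y2 := beta (pi g) *: quartic_gens i2 + (alpha (pi g) * (-1) ^+ p) *: quartic_gens i1.
have e1 : brk (brk c a1) g = brk (brk c a1) g' + Y1.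
  by rewrite [in LHS]gE !brkDr !brkZr.
have e2 : brk (brk c a2) g = brk (brk c a2) g' + Y2.
  by rewrite [in LHS]gE !brkDr !brkZr quartic_swap scalerA.
set S := \sum_i _; have -> : S = beta (pi f) *: Y2 + alpha (pi f) *: Y1.
  rewrite /S (bigD1 i0) // (bigD1 i1) // (bigD1 i2) //= big1 ?addr0; last first.
    by case=> [[|[|[|?]]] ?].
  rewrite /Y1 /Y2 !scalerDr !scalerA scalerDl [RHS]addrC -!addrA [RHS]addrCA.
  congr (_ + (_ + _)).
  by rewrite addrC; congr (_ *: _ + _ *: _); ring.
have -> : brk (brk c f) g = brk (brk c f') g
    + (beta (pi f) *: brk (brk c a2) g + alpha (pi f) *: brk (brk c a1) g).
  by rewrite [in LHS]fE !brkDr !brkDl !brkZr !brkZl.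
rewrite -addrA; apply: gsetD; first by apply: gbrk_mem => //; apply: perp_ker.
rewrite e1 e2 !scalerDr addrACA addrK.
by apply: gsetD; apply: gsetZ; apply: Dg; eassumption.
Qed.

Let brk_z x : brk x z = 0.
Proof. by rewrite (brk_skew_even x z_even) z_central oppr0. Qed.

Let alpha_linear a x y : alpha (a *: x + y) = a * alpha x + alpha y.
Proof. by rewrite /alpha brkDr brkZr gam_linear opprD mulrN. Qed.

Let beta_linear a x y : beta (a *: x + y) = a * beta x + beta y.
Proof. by rewrite /beta brkDr brkZr gam_linear. Qed.

Lemma gam_brk_part u q x : part p u = u ->
  gam (brk u (part q x)) = if q == p then gam (brk u x) else 0.
Proof.
have off r : part p u = u -> r != p -> gam (brk u (part r x)) = 0.
  move=> pu rp; rewrite -(brk_part _ _ _ _ pu (part_id r x)) gam_part.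
  by case: (p) r rp => [] [].
move=> pu; case: eqVneq => [->|]; last exact: off.
rewrite -[x in RHS](part_sum x) brkDr gamD.
have := off (~~ p) pu; case: (p) => /= -> //; by rewrite ?addr0 ?add0r.
Qed.

(** Odd vectors have a symmetric bracket, and here it is also alternating. *)
Lemma odd_char2 : p -> 2%:R = 0 :> K.
Proof.
move=> pt; have := brk_skew _ _ _ _ u2_deg u1_deg; rewrite u21 u12 pt expr1 scaleN1r opprK.
move=> zz; have : 2%:R *: z = 0 by rewrite scaler_nat mulr2n -{1}zz addNr.
by move/eqP; rewrite scaler_eq0 (negPf z_neq0) orbF => /eqP.
Qed.

(** Each of the words [1112], [1122] and [1222] occurs in exactly one of the
    three elements, for reasons of multidegree. *)
Lemma quartic_free (s : 'I_3 -> K) :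
  D (\sum_i s i *: quartic_gens i) -> forall i, s i = 0.
Proof.
move=> Ds i.
have alpha_part q x : alpha (part q x) = if q == p then alpha x else 0.
  by rewrite /alpha gam_brk_part //; case: eqP; rewrite ?oppr0.
have beta_part q x : beta (part q x) = if q == p then beta x else 0.
  by rewrite /beta gam_brk_part.
have alpha_brk x y : alpha (brk x y) = 0.
  by rewrite /alpha (form_brk x y) brkZr brk_z scaler0 gam0 oppr0.
have beta_brk x y : beta (brk x y) = 0.
  by rewrite /beta (form_brk x y) brkZr brk_z scaler0 gam0.
have gamN x : gam (- x) = - gam x by rewrite -scaleN1r gamZ mulN1r.
have u1_coord : alpha u1 = 1 /\ beta u1 = 0.
  by rewrite /alpha /beta u21 (square0 u1_deg) gamN gam_z gam0 opprK.
have u2_coord : alpha u2 = 0 /\ beta u2 = 1.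
  by rewrite /alpha /beta u12 (square0 u2_deg) gam_z gam0 oppr0.
have [th [th_lin thD thE]] := word4_coefficient P alpha_linear beta_linear gam_linear
  alpha_part beta_part gam_part alpha_brk beta_brk form_rank2 u1_deg u2_deg
  u1_coord u2_coord odd_char2 (fun t => 3 - i <= t)%N.
have th0 : th 0 = 0 by apply/thD/gset0.
have thZ a x : th (a *: x) = a * th x by rewrite -[_ *: _]addr0 th_lin th0 addr0.
have thAdd x y : th (x + y) = th x + th y by have := th_lin 1 x y; rewrite scale1r mul1r.
have := thD _ Ds; rewrite !big_ord_recl big_ord0 addr0 !thAdd !thZ.
rewrite /quartic_gens /= !thE //.
case: u1_coord u2_coord => -> -> [-> ->].
case: i {th thE th_lin thD th0 thZ thAdd} => [[|[|[|//]]] hi] /=;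
  rewrite !(mulr0, mul0r, subr0, sub0r, mulr1, mul1r, addr0, add0r, oppr0, opprK, mulrN, mulNr).
all: by move/eqP; rewrite ?oppr_eq0 => /eqP <-; congr s; apply: val_inj.
Qed.

Lemma quartic_rank2 : quartic_basis c quartic_gens.
Proof.
have even x y : part p x = x -> part p y = y -> part false (brk x y) = brk x y.
  by move=> px py; rewrite -(addbb p) brk_part.
have cdeg a : part p a = a -> part p (brk c a) = brk c a.
  by move=> pa; have := brk_part _ _ _ _ c_even pa; rewrite addFb.
split; [| |exact: quartic_rank2_span|exact: quartic_free].
  by case=> [[|[|i]] hi]; do 3?[apply: gbrk_mem => //].
by case=> [[|[|i]] hi]; apply: even => //; apply: cdeg.
Qed.

End Rank2.
Lemma quartic_pair : exists e (d : 'I_e -> F), (e = 0 \/ e = 3)%N /\ quartic_basis c d.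
Proof.
have [ab|] := pselect (forall x y, perp x -> perp y -> brk x y = 0).
  by exists 3%N, quartic_gens; split; [right | exact: quartic_rank2].
move=> /existsNP[x /existsNP[y /not_implyP[px /not_implyP[py /eqP xy]]]].
have [i [j ij]] := homogeneous_pair xy.
exists 0%N, (fun=> 0); split; first by left.
apply: quartic_basis0; apply: (quartic_rank4 (part_id i x) (part_id j y)) => //.
  exact: perp_part.
exact: perp_part.
Qed.

End Pair.

Hypothesis z_derived : lcs L 2 z.

(** An odd vector with nonzero square, if there is one, has to be used first:
    only in its absence is the form alternating, so that its rank decides. *)
Lemma exists_quartic : exists q (a1 a2 : F) e (d : 'I_e -> F),
  [/\ part q a1 = a1, part q a2 = a2, pi (brk a1 a2) = z, (e = 0 \/ e = 3)%N &
      quartic_basis (brk a1 a2) d].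
Proof.
have [[y [y1 yy]]|no_square] := pselect (exists y : L, part true y = y /\ brk y y != 0).
  have [a1 [a2 [h1 h2 h3 h4]]] := quartic_odd_square y1 yy.
  exists true, a1, a2, 0%N, (fun=> 0); split=> //; first by left.
  exact: quartic_basis0.
have square0 q (x : L) : part q x = x -> brk x x = 0.
  case: q => [x1|]; last exact: brk_even.
  by apply: contrapT => /eqP xx; apply: no_square; exists x.
have [x [y xy]] : exists x y : L, brk x y != 0.
  apply: contrapT => h; have [n [a [b [_ _ zE]]]] := z_derived.
  case/eqP: z_neq0; rewrite zE big1 // => i _.
  by apply: contrapT => /eqP ab; apply: h; exists (a i), (b i).
have [i [j ij]] := homogeneous_pair xy.
have [eij [s sz]] := normalize_pair (part_id i x) (part_id j y) ij.
have ix : part i (s *: part i x) = s *: part i x by rewrite linearZ /= part_id.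
have [a1 [a1_deg a1x]] := homogeneous_lift P ix.
have [a2 [a2_deg a2y]] := homogeneous_lift P (part_id j y).
rewrite -eij in a2_deg a2y sz.
have pc : pi (brk a1 a2) = z by rewrite piE a1x a2y.
have [e [d [h0 h1]]] := quartic_pair square0 a1_deg a2_deg pc.
by exists i, a1, a2, e, d.
Qed.

End Quartic.

(** * The dimension of the multiplier *)

Lemma lcs_succ_sub (K : fieldType) (F : lieSuperalgType K) n (f : F) :
  lcs F n.+2 f -> lcs F n.+1 f.
Proof.
apply: (gbrkP (A := lcs F n.+1) (B := gfull)) => x y nx _.
exact: (@lcs_ideal _ F n.+1 x y nx).1.
Qed.

Section Assembly.
Variables (K : fieldType) (L : lieSuperalgType K) (P : freePresentation L) (m l : nat).
Local Notation F := (fp_alg P).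
Local Notation pi := (@fp_map _ _ P).
Local Notation D := (mult2_den P).
Variables (z : L) (b : 'I_(m + l) -> L) (X : 'I_(m + l) -> L -> K) (gam : L -> K).
Hypothesis z_central : forall x, brk z x = 0.
Hypothesis L_derived : forall x y : L, exists a, brk x y = a *: z.
Hypothesis b_deg : forall i : 'I_(m + l), part (odd_index m i) (b i) = b i.
Hypothesis coordE : forall x, x = \sum_i X i x *: b i + gam x *: z.
Hypothesis X_linear : forall i a x y, X i (a *: x + y) = a * X i x + X i y.
Hypothesis X_part : forall (i : 'I_(m + l)) q x,
  X i (part q x) = if q == odd_index m i then X i x else 0.
Hypothesis X_b : forall i j, X i (b j) = (j == i)%:R.
Hypothesis X_z : forall i, X i z = 0.
Variables (p : bool) (a1 a2 : F) (e : nat) (d : 'I_e -> F).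
Hypothesis a1_deg : part p a1 = a1.
Hypothesis a2_deg : part p a2 = a2.
Hypothesis pi_c : pi (brk a1 a2) = z.
Hypothesis d_basis : quartic_basis (brk a1 a2) d.

(** Words of length three separate the Hall brackets and do not see degree four;
    hence the two parts can be treated one after the other. *)
Lemma multiplier2_dimension : exists a a' : nat,
  [/\ lie_isomorphic (multiplier2 P) (abelian_lie K a a'),
      3 * a + m = m ^ 3 + 3 * (m * l ^ 2) + 3 * e &
      3 * a' + l = l ^ 3 + 3 * (l * m ^ 2)]%N.
Proof.
have [d_lcs d_even d_span d_free] := d_basis.
have [v vP] := choice (fun i => homogeneous_lift P (b_deg i)).
have v_deg (i : 'I_(m + l)) : part (odd_index m i) (v i) = v i := (vP i).1.
have pi_v i : pi (v i) = b i := (vP i).2.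
pose I : finType := ({t : 'I_(m + l) * 'I_(m + l) * 'I_(m + l) | hall t} + 'I_e)%type.
pose h (t : I) := match t with inl u => hall_brk v (val u) | inr i => d i end.
pose deg (t : I) := match t with inl u => tri_deg (val u) | inr _ => false end.
have h_deg t : part (deg t) (h t) = h t.
  case: t => [[[[i j] k] ht]|i] /=; last exact: d_even.
  by rewrite /hall_brk /tri_deg /= !brk_part.
have lcs3 t : lcs F 3 (h t).
  case: t => [[[[i j] k] ht]|i] /=; last exact: lcs_succ_sub (d_lcs i).
  by do 2!apply: gbrk_mem => //.
have h_num t : mult2_num P (h t) by split; [apply: (lcs3_ker z_central L_derived)|].
have h_sum (s : I -> K) : \sum_t s t *: h t =
    \sum_u s (inl u) *: hall_brk v (val u) + \sum_i s (inr i) *: d i.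
  by rewrite big_sumType.
have h_span x : mult2_num P x -> exists s : I -> K, D (x - \sum_t s t *: h t).
  case=> _ x3; pose T y := exists s : 'I_e -> K, D (y - \sum_i s i *: d i).
  have T_lin a y y' : T y -> T y' -> T (a *: y + y').
    move=> [s sy] [s' sy']; exists (fun i => a * s i + s' i).
    have -> : a *: y + y' - \sum_i (a * s i + s' i) *: d i =
        a *: (y - \sum_i s i *: d i) + (y' - \sum_i s' i *: d i).
      rewrite scalerBr addrACA -opprD scaler_sumr -big_split /=; congr (_ - _).
      by apply: eq_bigr => i _; rewrite scalerDl scalerA.
    exact: gset_linear.
  have T_den y : D y -> T y.
    move=> Dy; exists (fun=> 0); rewrite big1 ?subr0 // => i _; exact: scale0r.
  have [s [s' ss']] := hall_span_lcs3 L_derived a1_deg a2_deg pi_c coordE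
    v_deg pi_v T_lin T_den d_span x3.
  exists (fun t => match t with inl u => s u | inr i => s' i end).
  by rewrite h_sum /= opprD addrA.
have X_brk i x y : X i (brk x y) = 0.
  have [a ->] := L_derived x y; have X0 : X i 0 = 0.
    by have := X_linear i (-1) 0 0; rewrite scaler0 addr0 mulN1r addNr.
  by rewrite -[_ *: _]addr0 X_linear X_z X0 mulr0 addr0.
have h_free (s : I -> K) : D (\sum_t s t *: h t) -> forall t, s t = 0.
  rewrite h_sum => Ds.
  have s4 : lcs F 4 (\sum_i s (inr i) *: d i).
    by apply: gset_fsum => i _; apply: gsetZ.
  have s_hall u : s (inl u) = 0.
    exact: (hall_free X_linear X_part X_b X_brk v_deg pi_v s4 Ds).
  case=> [u|i]; first exact: s_hall.
  apply: (d_free (fun i => s (inr i))); move: Ds.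
  by rewrite big1 ?add0r // => u _; rewrite s_hall scale0r.
exists #|[pred t | ~~ deg t]|, #|[pred t | deg t]|; split.
- exact: multiplier2_iso.
- rewrite -sum1_card big_sumType /= sum1_card sum1_card -(card_hall_even m l).
  have -> : #|(fun i : 'I_e => ~~ deg (inr i)) : pred _| = e.
    by rewrite (eq_card (B := predT)) ?card_ord.
  by rewrite mulnDr addnAC; congr (3 * _ + _ + _)%N; apply: eq_card.
- rewrite -sum1_card big_sumType /= sum1_card sum1_card -(card_hall_odd m l).
  rewrite [X in (_ * (_ + X))%N](eq_card (B := pred0)) // card0 addn0.
  by congr (3 * _ + _)%N; apply: eq_card.
Qed.

End Assembly.

Theorem lemma5p14 (K : closedFieldType) (L : lieSuperalgType K) (k l : nat)
    (Lnil : nilpotent_lie L)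
    (Ldim : has_sdim (gfull : gradedSubspace L) k l)
    (L2dim : has_sdim (lcs L 2) 1 0)
    (P : freePresentation L) :
  let k' : rat := k%:R in
  let l' : rat := l%:R in
  let f0 : rat := 1 / 3 * k' * (k' - 1) * (k' + 1) + (k' - 1) * (l' ^+ 2 - k') in
  let f1 : rat := 1 / 3 * l' * (l' - 1) * (l' + 1) + l' * (k' - 1) ^+ 2 in
  exists a b : nat,
    lie_isomorphic (multiplier2 P) (abelian_lie K a b) /\
    [\/ a%:R = f0 /\ b%:R = f1,
        a%:R = f0 + 1 /\ b%:R = f1 + 1
      | a%:R = f0 + 3 /\ b%:R = f1].
Proof.
move=> k' l' f0 f1.
have [z [z0 zn0 L2z L2span]] := derived_line L2dim.
have zc := derived_central Lnil z0 zn0 L2z L2span.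
have Lder (x y : L) : exists a, brk x y = a *: z by apply/L2span/gbrk_mem.
have [m [km [b [X [gam [b_deg coordE [X_lin X_part X_b X_z] [gam_lin gam_part gam_z]]]]]]]
  := adapted_coordinates Ldim z0 zn0.
have [p [a1 [a2 [e [d [a1_deg a2_deg pc e03 dB]]]]]] :=
  exists_quartic P z0 zn0 zc Lder gam_lin gam_part gam_z L2z.
have [a [a' [iso ea ea']]] := multiplier2_dimension zc Lder b_deg coordE
  X_lin X_part X_b X_z a1_deg a2_deg pc dB.
have kE : k' = m%:R + 1 by rewrite /k' km natr1.
have aE : a%:R = f0 + e%:R :> rat.
  have := congr1 (fun n => n%:R : rat) ea; rewrite /= !(natrD, natrM, natrX).
  rewrite /f0 kE -/l'; lra.
have a'E : a'%:R = f1 :> rat.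
  have := congr1 (fun n => n%:R : rat) ea'; rewrite /= !(natrD, natrM, natrX).
  rewrite /f1 kE -/l'; lra.
exists a, a'; split=> //; case: e03 aE => -> aE; first by apply: Or31; rewrite aE addr0.
exact: Or33.
Qed.
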